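(* Let $\mathcal{H},\mathcal{K}$ be real Hilbert spaces, let $X$ be a closed subset of $\mathbb{R}^d$, and let $L\colon\mathbb{R}[\underline{x}]\otimes B(\mathcal{H})_h\to B(\mathcal{K})_h$ be a linear map, where $\mathbb{R}[\underline{x}]=\mathbb{R}[x_1,\ldots,x_d]$. Suppose that $(L\otimes\operatorname{Id}_{M_n(\mathbb{R})})(G)\succeq 0$ for every $n\in\mathbb{N}$ and every symmetric polynomial $G\in\mathbb{R}[\underline{x}]\otimes B(\mathcal{H})_h\otimes M_n(\mathbb{R})$ such that $G(a)\succeq 0$ for every $a\in X$. Then there exists a non-negative operator-valued measure $m\colon\operatorname{Bor}(X)\to\mathcal{L}(B(\mathcal{H})_h,B(\mathcal{K})_h)$ such that $L(F)=\int F\,dm$ for every $F\in\mathbb{R}[\underline{x}]\otimes B(\mathcal{H})_h$.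
   Context: All Hilbert spaces are real. For a Hilbert space $\mathcal{H}$, $B(\mathcal{H})$ is the algebra of bounded linear operators on $\mathcal{H}$, $B(\mathcal{H})_h$ is the real Banach space of self-adjoint ones, and $B(\mathcal{H})_+$ is the set of positive semidefinite ones (written $A\succeq 0$). $\mathcal{L}(B(\mathcal{H})_h,B(\mathcal{K})_h)$ is the Banach space of bounded linear operators from $B(\mathcal{H})_h$ to $B(\mathcal{K})_h$. $\operatorname{Bor}(X)$ is the Borel $\sigma$-algebra of $X$. An element $G$ of $\mathbb{R}[\underline{x}]\otimes B(\mathcal{H})_h\otimes M_n(\mathbb{R})$ is an $n\times n$ matrix $[G_{jl}]$ with entries in $\mathbb{R}[\underline{x}]\otimes B(\mathcal{H})_h$; it is symmetric if $G_{jl}=G_{lj}$ for all $j,l$. $G(a)=[G_{jl}(a)]$ is regarded as an operator on $\mathcal{H}^n$, and $(L\otimes\operatorname{Id}_{M_n(\mathbb{R})})(G)=[L(G_{jl})]$ as an operator on $\mathcal{K}^n$. Let $\mathcal{P}$ be a $\sigma$-algebra of subsets of a set $X$. A positive operator-valued measure is a set function $E\colon\mathcal{P}\to B(\mathcal{K})_h$ such that: (a) $E(\Delta)\succeq 0$ for all $\Delta\in\mathcal{P}$; (b) $E(\Delta_1\cup\Delta_2)=E(\Delta_1)+E(\Delta_2)$ for disjoint $\Delta_1,\Delta_2\in\mathcal{P}$; (c) if $\Delta_i$ is an increasing sequence in $\mathcal{P}$ with union $\Delta\in\mathcal{P}$, then $E(\Delta)=\sup_i E(\Delta_i)$. A non-negative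 operator-valued measure is a set function $m\colon\mathcal{P}\to\mathcal{L}(B(\mathcal{H})_h,B(\mathcal{K})_h)$ such that for every $A\in B(\mathcal{H})_+$ the set function $m_A\colon\mathcal{P}\to B(\mathcal{K})_h$, $m_A(\Delta)=m(\Delta)(A)$, is a positive operator-valued measure. Integration. For a positive operator-valued measure $E$ and $x\in\mathcal{K}$ let $E_x(\Delta)=\langle E(\Delta)x,x\rangle$. A measurable $f\colon X\to\mathbb{R}$ is $E$-integrable if there is a constant $K_f$ with $\int|f|\,dE_x\le K_f\|x\|^2$ for all $x\in\mathcal{K}$; then $\int f\,dE\in B(\mathcal{K})_h$ is the unique operator with $\langle(\int f\,dE)x,x\rangle=\int f\,dE_x$ for all $x\in\mathcal{K}$. Let $\mathcal{I}$ be the space of measurable real functions on $X$ that are $m_A$-integrable for every $A\in B(\mathcal{H})_+$. For $f\in\mathcal{I}$ and $A\in B(\mathcal{H})_h$ put $\int f\,dm_A=\int f\,dm_{A_+}-\int f\,dm_{A_-}$, where $A_+,A_-\in B(\mathcal{H})_+$ are the positive and negative parts of $A$ ($A=A_+-A_-$, $A_+A_-=A_-A_+=0$). For $F=\sum_i f_i\otimes A_i\in\mathcal{I}\otimes B(\mathcal{H})_h$ (algebraic tensor product) put $\int F\,dm=\sum_i\int f_i\,dm_{A_i}$. Elements $F=\sum_i p_i\otimes A_i$ of $\mathbb{R}[\underline{x}]\otimes B(\mathcal{H})_h$ are polynomials with coefficients in $B(\mathcal{H})_h$; in $\int F\,dm$ the polynomials $p_i$ are regarded as functions on $X$, and the formula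 $L(F)=\int F\,dm$ includes the assertion that these functions lie in $\mathcal{I}$. *)

(* Defs.v *)
From HB Require Import structures.
From mathcomp Require Import all_boot all_order all_algebra finmap.
(* The notations of mpoly clash with those of MathComp-Analysis. *)
From mathcomp Require Import -(notations) mpoly.
From mathcomp Require Import all_classical all_reals all_analysis.

Set Implicit Arguments.
Unset Strict Implicit.
Unset Printing Implicit Defensive.

Import Order.TTheory GRing.Theory Num.Theory.
Import numFieldNormedType.Exports.

Local Open Scope classical_set_scope.
Local Open Scope ring_scope.

HB.mixin Record CompleteNormedModule_isHilbert (R : realType) H
    & CompleteNormedModule R H := {
  inner : H -> H -> R ;
  innerC : forall x y, inner x y = inner y x ;
  innerDZl : forall (c : R) x y z,
    inner (c *: x + y) z = c * inner x z + inner y z ;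
  innerxx : forall x, inner x x = `|x| ^+ 2
}.

#[short(type="hilbertType")]
HB.structure Definition Hilbert (R : realType) :=
  {H of CompleteNormedModule R H & CompleteNormedModule_isHilbert R H}.

Section InnerProduct.
Context {R : realType} {H : hilbertType R}.
Implicit Types x y z : H.

Lemma innerDl x y z : inner (x + y) z = inner x z + inner y z.
Proof. by rewrite -{1}(scale1r x) innerDZl mul1r. Qed.

Lemma inner0l z : inner 0 z = 0.
Proof. by apply: (addIr (inner 0 z)); rewrite -innerDl !add0r. Qed.

Lemma innerZl c x z : inner (c *: x) z = c * inner x z.
Proof. by rewrite -{1}(addr0 (c *: x)) innerDZl inner0l addr0. Qed.

Lemma innerDr x y z : inner z (x + y) = inner z x + inner z y.
Proof. by rewrite innerC innerDl !(innerC z). Qed.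

Lemma innerZr c x z : inner z (c *: x) = c * inner z x.
Proof. by rewrite innerC innerZl innerC. Qed.

End InnerProduct.

Section SelfAdjoint.
Context {R : realType} (H : hilbertType R).

Definition selfadjoint_spec (A : H -> H) : Prop :=
  [/\ linear A,
      exists k : R, forall x, `|A x| <= k * `|x|
    & forall x y, inner (A x) y = inner x (A y)].

Definition selfadjoint : {pred H -> H} := fun A => `[< selfadjoint_spec A >].

(* [Bh H] is B(H)_h. *)
Record Bh := MkBh { Bh_fun :> H -> H ; _ : Bh_fun \in selfadjoint }.

HB.instance Definition _ := [isSub for Bh_fun].
HB.instance Definition _ := [Choice of Bh by <:].

Lemma selfadjoint_submod_closed : submod_closed selfadjoint.
Proof.
split.
  apply/asboolP; split => [c x y|| x y]; rewrite ?scaler0 ?addr0 //.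
  - by exists 0 => x; rewrite mul0r normr0.
  - by rewrite inner0l innerC inner0l.
move=> c A B /asboolP[lA [kA bA] sA] /asboolP[lB [kB bB] sB].
apply/asboolP; split.
- move=> e x y; rewrite !fctE lA lB !scalerDr !scalerA (mulrC c e).
  by rewrite -!addrA; congr (_ + _); rewrite addrCA.
- exists (`|c| * kA + kB) => x; rewrite fctE (le_trans (ler_normD _ _))//.
  rewrite mulrDl lerD ?bB// normrZ -mulrA ler_wpM2l//.
- by move=> x y; rewrite !fctE innerDZl innerDr innerZr sA sB.
Qed.

HB.instance Definition _ :=
  GRing.isSubmodClosed.Build R (H -> H) selfadjoint selfadjoint_submod_closed.
HB.instance Definition _ := [SubChoice_isSubLmodule of Bh by <:].

Lemma BhP (A : Bh) : selfadjoint_spec A.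
Proof. by apply/asboolP; exact: (valP A). Qed.

Definition opnorm (A : Bh) : R := sup [set `|A x| | x in [set x | `|x| <= 1]].

Lemma opnorm_has_sup (A : Bh) :
  has_sup [set `|A x| | x in [set x | `|x| <= 1]].
Proof.
have [_ [k bA] _] := BhP A; split.
  by exists `|A 0|, 0 => //=; rewrite normr0 ler01.
exists `|k| => _ [x /= x1 <-]; apply: (le_trans (bA x)).
apply: (@le_trans _ _ (`|k| * `|x|)).
  by rewrite ler_wpM2r// ler_norm.
by rewrite ler_piMr.
Qed.

Lemma opnorm_ub (A : Bh) x : `|x| <= 1 -> `|A x| <= opnorm A.
Proof. by move=> x1; apply: (ub_le_sup (opnorm_has_sup A).2); exists x. Qed.

Lemma opnorm_lub (A : Bh) k :
  (forall x, `|x| <= 1 -> `|A x| <= k) -> opnorm A <= k.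
Proof.
by move=> Ak; apply: (ge_sup (opnorm_has_sup A).1) => _ [x x1 <-]; exact: Ak.
Qed.

Lemma opnorm_ge0 (A : Bh) : 0 <= opnorm A.
Proof. by apply: (le_trans (normr_ge0 (A 0))); apply: opnorm_ub; rewrite normr0. Qed.

Let opnormD (A B : Bh) : opnorm (A + B) <= opnorm A + opnorm B.
Proof.
apply: opnorm_lub => x x1; rewrite (_ : (A + B) x = A x + B x)//.
by rewrite (le_trans (ler_normD _ _))// lerD// opnorm_ub.
Qed.

Let opnormZ_le (c : R) (A : Bh) : opnorm (c *: A) <= `|c| * opnorm A.
Proof.
apply: opnorm_lub => x x1; rewrite (_ : (c *: A) x = c *: A x)//.
by rewrite normrZ ler_wpM2l// opnorm_ub.
Qed.

Let opnormZ (c : R) (A : Bh) : opnorm (c *: A) = `|c| * opnorm A.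
Proof.
apply/eqP; rewrite eq_le opnormZ_le/=.
have [->|c0] := eqVneq c 0; first by rewrite normr0 mul0r opnorm_ge0.
rewrite mulrC -ler_pdivlMr ?normr_gt0//.
have := opnormZ_le c^-1 (c *: A).
by rewrite scalerA mulVf// scale1r normfV mulrC.
Qed.

Let opnorm0_eq0 (A : Bh) : opnorm A = 0 -> A = 0.
Proof.
move=> A0; apply/val_inj/funext => x /=.
have [lA _ _] := BhP A.
have AZ c y : A (c *: y) = c *: A y.
  have A00 : A 0 = 0.
    by apply: (addIr (A 0)); rewrite add0r -{1}(scale1r (A 0)) -lA scaler0 addr0.
  by rewrite -{1}(addr0 (c *: y)) lA A00 addr0.
have [x0|x0] := eqVneq `|x| 0.
  by move/normr0_eq0: x0 => ->; have := AZ 0 0; rewrite !scale0r.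
have : `|A (`|x|^-1 *: x)| <= opnorm A.
  by apply: opnorm_ub; rewrite normrZ normfV normr_id mulVf.
rewrite A0 normr_le0 AZ scaler_eq0 invr_eq0 (negbTE x0)/=.
by move/eqP.
Qed.

HB.instance Definition _ :=
  @Lmodule_isNormed.Build R Bh opnorm opnormD opnormZ opnorm0_eq0.

Lemma Bh_normE (A : Bh) : `|A| = opnorm A.
Proof. by []. Qed.

Definition psd (A : Bh) : Prop := forall x, 0 <= inner (A x) x.

(* A block matrix acts on H^n by (M v)_j = \sum_l M j l (v l); the inner
   product of H^n is the sum of the coordinatewise ones. *)
Definition block_psd (n : nat) (M : 'M[Bh]_n) : Prop :=
  forall v : 'I_n -> H, 0 <= \sum_j inner (\sum_l M j l (v l)) (v j).

Definition pos_neg_parts (A : Bh) : set (Bh * Bh) :=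
  [set PN | [/\ psd PN.1, psd PN.2, A = PN.1 - PN.2,
    forall x, PN.1 (PN.2 x) = 0 & forall x, PN.2 (PN.1 x) = 0]].

(* The pair (A_+, A_-). *)
Definition posneg (A : Bh) : Bh * Bh := xget (0, 0) (pos_neg_parts A).

End SelfAdjoint.

Record blinear (R : realType) (V W : normedModType R) := MkBlinear {
  blinear_fun :> {linear V -> W} ;
  blinearP : exists k : R, forall v, `|blinear_fun v| <= k * `|v| }.

Section VectorPolynomials.
Context {R : realType} (d : nat) (V : lmodType R).

Definition finsupported : {pred multinom d -> V} :=
  fun F => `[< finite_set [set k | F k != 0] >].

(* [vpoly d V] is the algebraic tensor product R[x_1, ..., x_d] (x) V, i.e. the
   polynomials with coefficients in V, as finitely supported coefficient
   families. *)
Record vpoly :=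
  MkVpoly { vpoly_coef :> multinom d -> V ; _ : vpoly_coef \in finsupported }.

HB.instance Definition _ := [isSub for vpoly_coef].
HB.instance Definition _ := [Choice of vpoly by <:].

Lemma finsupported_submod_closed : submod_closed finsupported.
Proof.
split.
  apply/asboolP; rewrite (_ : [set k | _] = set0)//.
  by apply/seteqP; split => // k /=; rewrite eqxx.
move=> c F G /asboolP fF /asboolP fG; apply/asboolP.
apply: sub_finite_set (_ : finite_set ([set k | F k != 0] `|` [set k | G k != 0])).
  move=> k /=; apply: contraPP => /not_orP[/negP/negPn/eqP Fk /negP/negPn/eqP Gk].
  by rewrite !fctE Fk Gk scaler0 addr0 eqxx.
by rewrite finite_setU.
Qed.

HB.instance Definition _ :=
  GRing.isSubmodClosed.Build R (multinom d -> V) finsupported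
    finsupported_submod_closed.
HB.instance Definition _ := [SubChoice_isSubLmodule of vpoly by <:].

Lemma tens_subproof (p : mpoly d R) (A : V) :
  (fun k => mcoeff k p *: A) \in finsupported.
Proof.
apply/asboolP/(sub_finite_set _ (finite_seq (msupp p))) => k /=.
by apply: contraNT; rewrite -mcoeff_eq0 => /eqP ->; rewrite scale0r.
Qed.

(* The elementary tensor p (x) A. *)
Definition tens (p : mpoly d R) (A : V) : vpoly := MkVpoly (tens_subproof p A).

Definition veval (a : 'I_d -> R) (F : vpoly) : V :=
  \sum_(k \in [set: multinom d]) mmap1 a k *: F k.

Lemma vpoly_finite (F : vpoly) : finite_set [set k | F k != 0].
Proof. by apply/asboolP; exact: (valP F). Qed.

Lemma vpoly_sumE I (r : seq I) (F : I -> vpoly) k :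
  (\sum_(i <- r) F i : vpoly) k = \sum_(i <- r) F i k.
Proof. by elim/big_rec2: _ => // i _ y _ <-. Qed.

(* Every vpoly is a finite sum of elementary tensors. *)
Lemma vpoly_tensE (F : vpoly) :
  F = \sum_(k <- fset_set [set k | F k != 0]) tens (mpolyX R k) (F k).
Proof.
apply/val_inj/funext => k; rewrite /= vpoly_sumE /=.
under eq_bigr do rewrite mcoeffX.
have [kF|kF] := boolP (k \in fset_set [set k | F k != 0]).
  rewrite (big_rem k)//= eqxx scale1r big_seq big1 ?addr0// => j.
  rewrite mem_rem_uniq ?fset_uniq// inE => /andP[/negbTE-> _].
  by rewrite scale0r.
rewrite big_seq big1.
  move: kF; rewrite in_fset_set; last exact: vpoly_finite.
  by rewrite notin_setE /= => /negP/negPn/eqP.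
move=> j jF; case: eqVneq => [jk|]; last by rewrite scale0r.
by rewrite -jk jF in kF.
Qed.

Lemma veval_tens a p A : veval a (tens p A) = meval a p *: A.
Proof.
rewrite /veval mevalE scaler_suml (fsbigTE [fset k | k in msupp p]%fset)/=.
  rewrite [RHS](perm_big [fset k | k in msupp p]%fset)/=.
    by apply: eq_bigr => k _; rewrite scalerA mulrC.
  by rewrite uniq_perm ?msupp_uniq// => k; rewrite !inE.
move=> k; rewrite !inE /= -mcoeff_eq0 => /eqP ->.
by rewrite scale0r scaler0.
Qed.

End VectorPolynomials.

Section OperatorValuedMeasures.
Context {R : realType}.

(* P is the sigma-algebra on which E is considered; the values of E outside of
   P are irrelevant.  The supremum in the last clause is taken in B(K)_h for
   the order A <= B iff B - A is positive semidefinite. *)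
Definition povm {T : Type} {K : hilbertType R} (P : set (set T))
    (E : set T -> Bh K) : Prop :=
  [/\ forall D, P D -> psd (E D),
      forall D1 D2, P D1 -> P D2 -> D1 `&` D2 = set0 ->
        E (D1 `|` D2) = E D1 + E D2
    & forall D : (set T)^nat, (forall i, P (D i)) ->
        (forall i, D i `<=` D i.+1) -> P (\bigcup_i D i) ->
        (forall i, psd (E (\bigcup_i D i) - E (D i))) /\
        (forall B : Bh K, (forall i, psd (B - E (D i))) ->
          psd (B - E (\bigcup_i D i)))].

Definition novm {T : Type} {H K : hilbertType R} (P : set (set T))
    (m : set T -> blinear (Bh H) (Bh K)) : Prop :=
  forall A : Bh H, psd A -> povm P (fun D => m D A).

(* Integration over a measurable subset X of T with respect to operator-valued
   measures on the measurable subsets of X. *)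
Section Integral.
Context {disp : measure_display} {T : measurableType disp}.
Context {H K : hilbertType R}.
Implicit Types (E : set T -> Bh K) (m : set T -> blinear (Bh H) (Bh K)).
Implicit Types (X : set T) (f : T -> R).

(* The measure E_x, extended by zero outside of X. *)
Definition povm_form E X (x : K) : set T -> \bar R :=
  fun D => (inner (E (D `&` X) x) x)%:E.

Definition povm_integrable E X f : Prop :=
  measurable_fun X f /\
  exists k : R, forall x : K,
    (\int[povm_form E X x]_(a in X) `|f a|%:E <= (k * `|x| ^+ 2)%:E)%E.

Definition povm_integral E X f : Bh K :=
  xget 0 [set S : Bh K | forall x : K,
    (inner (S x) x)%:E = (\int[povm_form E X x]_(a in X) (f a)%:E)%E].

Definition novm_integrable m X f : Prop :=
  forall A : Bh H, psd A -> povm_integrable (fun D => m D A) X f.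

Definition novm_integral m X f (A : Bh H) : Bh K :=
  povm_integral (fun D => m D (posneg A).1) X f -
  povm_integral (fun D => m D (posneg A).2) X f.

End Integral.

End OperatorValuedMeasures.

(* Bor(X), for the subspace topology on X. *)
Definition borel {T : topologicalType} (X : set T) : set (set T) :=
  <<s X, [set U `&` X | U in @open T] >>.

Notation borelR R d := (g_sigma_algebraType (@open 'rV[R]_d)).

(* The sets in Bor(X) are the measurable subsets of X, as required for
   integration. *)
Lemma borel_closedE (R : realType) (d : nat) (X : set 'rV[R]_d) : closed X ->
  borel X = [set D | measurable (D : set (borelR R d)) /\ D `<=` X].
Proof.
move=> cX.
have mX : measurable (X : set (borelR R d)).
  rewrite -(setCK X); apply: measurableC; apply: sub_sigma_algebra.
  exact: closed_openC.
apply/seteqP; split.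
  apply: smallest_sub; first split => /=.
  - by split => //; exact: measurable0.
  - move=> A [mA AX]; split; last exact: subDsetl.
    exact: (@measurableD _ (borelR R d)).
  - move=> A mA; split; last by apply: bigcup_sub => i _; exact: (mA i).2.
    by apply: (@bigcupT_measurable _ (borelR R d)) => i; exact: (mA i).1.
  move=> _ [U oU <-]; split; last exact: subIsetr.
  apply: (@measurableI _ (borelR R d)) => //; exact: sub_sigma_algebra.
move=> D [mD DX]; rewrite -(setIidl DX).
have oX : @open 'rV[R]_d `<=` [set A | borel X (A `&` X)].
  by move=> U oU; apply: sub_sigma_algebra; exists U.
apply: (smallest_sub _ oX mD); split => /=.
- by rewrite set0I; exact: sigma_algebra0.
- move=> A bA; rewrite (_ : _ `&` _ = X `\` (A `&` X)).
    exact: sigma_algebraCD.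
  by rewrite setDIr setDv setU0 setTD setIC setDE.
- by move=> A bA; rewrite setI_bigcupl; exact: sigma_algebra_bigcup.
Qed.

(* Main.v *)
From HB Require Import structures.
Require Import Defs.
From mathcomp Require Import all_boot all_order all_algebra finmap.
From mathcomp Require Import ring lra.
From mathcomp Require Import -(notations) mpoly.
From mathcomp Require Import all_classical all_reals all_analysis measurable_realfun.
Set Implicit Arguments.
Unset Strict Implicit.
Unset Printing Implicit Defensive.
Import Order.TTheory GRing.Theory Num.Theory.
Import numFieldNormedType.Exports.
Local Open Scope classical_set_scope.
Local Open Scope ring_scope.

(** The idea is to replace L by one positive scalar functional and to extend
    that functional far enough for measures to become visible.

    To a finite family of pairs (F, x), with F an operator polynomial and x in
    K, attach the function (a, T) |-> \sum <F(a) T x, T x> of a point a of X and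
    a linear map T : K -> H, and the number \sum <L(F) x, x>.  In coordinates
    with respect to an orthonormal basis of the span of the vectors x, the
    nonnegativity of the function for all T is the nonnegativity on X of one
    symmetric matrix polynomial; so the assumption on all matrix sizes makes the
    functional positive for the pointwise order ([quadL_ge0]).  M. Riesz's
    theorem ([riesz_extension]) extends it to a positive functional Phi on the
    functions f(a) <A T x, T y>, where f is any function that a polynomial
    bounds on X, measurable or not ([functional_extension]).  A representing
    measure chosen separately for every A and x would not depend linearly on A
    or quadratically on x, because moment problems may be indeterminate; the
    single functional Phi makes all the choices consistently.

    The values of Phi at indicator functions f are finitely additive in the set.
    Countable additivity is gained on the space of ultrafilters on R^d: the sets
    of all ultrafilters containing a given set form an algebra of compact sets,
    on which finitely additive functions are premeasures ([stone_extension]).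
    The resulting measure is transported to R^d by the map that sends an
    ultrafilter to its limit.  Markov's inequality for polynomials shows that
    almost every ultrafilter contains a bounded set, so it has a limit; the
    limit lies in X because X is closed.  The same inequality controls the
    tails in the computation of the integrals of polynomials, which are the
    values of Phi ([integral_peval]).

    Linear relations between finitely additive functions persist between their
    measures by the pi-lambda theorem ([measure_relation], [signed_extension]).
    For a fixed Borel set one therefore gets a bounded form that is bilinear in
    (x, y) and linear in A, and the Riesz representation theorem turns it into
    the operator m(D)(A) ([form_blinear], [scalar_measures]).

    Integration with respect to m_A for general A goes through A = A_+ - A_-.
    These parts are (|A| + A) / 2 and (|A| - A) / 2, where |A| is the square
    root of A^2 given by a monotone iteration ([pos_neg_parts_exists]). *)

(** * Hilbert space geometry *)

Section Inner.
Context {R : realType} {H : hilbertType R}.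
Implicit Types (x y z : H) (A : Bh H).

Lemma innerNl x z : inner (- x) z = - inner x z.
Proof. by rewrite -scaleN1r innerZl mulN1r. Qed.

Lemma innerNr x z : inner z (- x) = - inner z x.
Proof. by rewrite innerC innerNl innerC. Qed.

Lemma innerBl x y z : inner (x - y) z = inner x z - inner y z.
Proof. by rewrite innerDl innerNl. Qed.

Lemma innerBr x y z : inner z (x - y) = inner z x - inner z y.
Proof. by rewrite innerDr innerNr. Qed.

Lemma inner0r z : inner z 0 = 0.
Proof. by rewrite innerC inner0l. Qed.

Lemma inner_suml I (r : seq I) (P : pred I) (F : I -> H) z :
  inner (\sum_(i <- r | P i) F i) z = \sum_(i <- r | P i) inner (F i) z.
Proof. by apply: (big_morph (inner^~ z)) => [x y|]; rewrite ?innerDl ?inner0l. Qed.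

Lemma inner_sumr I (r : seq I) (P : pred I) (F : I -> H) z :
  inner z (\sum_(i <- r | P i) F i) = \sum_(i <- r | P i) inner z (F i).
Proof. by rewrite innerC inner_suml; apply: eq_bigr => i _; rewrite innerC. Qed.

Lemma normD_sqr x y : `|x + y| ^+ 2 = `|x| ^+ 2 + 2 * inner x y + `|y| ^+ 2.
Proof. by rewrite -!innerxx !innerDl !innerDr (innerC y x); ring. Qed.

Lemma normB_sqr x y : `|x - y| ^+ 2 = `|x| ^+ 2 - 2 * inner x y + `|y| ^+ 2.
Proof. by rewrite normD_sqr innerNr normrN; ring. Qed.

Lemma inner_le_sqr x y : `|inner x y| <= (`|x| ^+ 2 + `|y| ^+ 2) / 2.
Proof.
have := sqr_ge0 `|x + y|; have := sqr_ge0 `|x - y|.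
rewrite normB_sqr normD_sqr => h1 h2; rewrite ler_norml; lra.
Qed.

Lemma cauchy_schwarz x y : `|inner x y| <= `|x| * `|y|.
Proof.
have [->|x0] := eqVneq x 0; first by rewrite inner0l !normr0 mul0r.
have [->|y0] := eqVneq y 0; first by rewrite inner0r !normr0 mulr0.
have := inner_le_sqr (`|x|^-1 *: x) (`|y|^-1 *: y).
have nx : 0 < `|x| by rewrite normr_gt0.
have ny : 0 < `|y| by rewrite normr_gt0.
rewrite !normrZ !normfV !normr_id !mulVf ?gt_eqF// innerZl innerZr !normrM.
rewrite !normfV !normr_id expr1n mulrA -(invfM `|x|) mulrC ler_pdivrMr ?mulr_gt0//.
by rewrite [X in X * _](_ : _ = 1) ?mul1r//; field.
Qed.

Lemma inner_nondeg x y : (forall z, inner x z = inner y z) -> x = y.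
Proof.
move=> h; apply/eqP; rewrite -subr_eq0 -normr_eq0 -sqrf_eq0 -innerxx.
by rewrite innerBl h subrr.
Qed.

Lemma complete_seq (u : nat -> H) (e : nat -> R) :
  (forall n m, (n <= m)%N -> `|u n - u m| <= e n) -> e @ \oo --> 0 ->
  exists l : H, u @ \oo --> l.
Proof.
move=> ue e0; suff h : cvg (u @ \oo) by exists (lim (u @ \oo)).
apply: cauchy_cvg; apply: cauchy_exP => _/posnumP[d].
have /cvgrPdist_lt/(_ d%:num)[//|N _ eN] := e0.
exists (u N); exists N => // m /= Nm; rewrite -ball_normE /=.
apply: le_lt_trans (ue _ _ Nm) _; have := eN N (leqnn N).
by rewrite /= sub0r normrN; apply: le_lt_trans; exact: ler_norm.
Qed.

Lemma cvg_innerl (u : nat -> H) (l : H) y :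
  u @ \oo --> l -> (fun n => inner (u n) y) @ \oo --> inner l y.
Proof.
move=> ul; apply/cvgrPdist_lt => _/posnumP[d].
have y0 : 0 < 1 + `|y| by rewrite ltr_wpDr.
have /cvgrPdist_lt/(_ (d%:num / (1 + `|y|))) := ul.
case=> [|N _ uN]; first exact: divr_gt0.
exists N => // n /= Nn; rewrite -innerBl; apply: le_lt_trans (cauchy_schwarz _ _) _.
have := uN n Nn; rewrite /= ltr_pdivlMr//; apply: le_lt_trans.
by rewrite ler_wpM2l// lerDr.
Qed.

End Inner.

Lemma seq_ge {R : realType} (u : nat -> R) (l : R) a :
  u @ \oo --> l -> (forall n, a <= u n) -> a <= l.
Proof.
move=> ul au; rewrite -(cvg_lim _ ul)//; apply: limr_ge; first by apply/cvg_ex; exists l.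
exact: nearW.
Qed.

Section Projection.
Context {R : realType} {H : hilbertType R}.
Implicit Types (x y z : H).

(** A minimizing sequence for the distance from x to M is Cauchy by the
    parallelogram law.  Its limit v lies in the closure of M; the sequence u
    serves to carry properties of M over to v. *)
Lemma projection (M : set H) x : M 0 ->
  (forall c y z, M y -> M z -> M (c *: y + z)) ->
  exists2 v : H, exists2 u : nat -> H, forall n, M (u n) & u @ \oo --> v
    & forall y, M y -> inner (x - v) y = 0.
Proof.
move=> M0 Mlin.
pose D := [set `|x - y| ^+ 2 | y in M].
have Dinf : has_inf D.
  by split; [exists (`|x - 0| ^+ 2), 0 | exists 0 => _ [y _ <-]; exact: sqr_ge0].
pose e n : R := (n.+1%:R)^-1.
have e_gt0 n : 0 < e n by rewrite invr_gt0.
have e_le n m : (n <= m)%N -> e m <= e n.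
  by move=> nm; rewrite lef_pV2 ?posrE ?ler_nat.
have /choice[u uP] n : exists y, M y /\ `|x - y| ^+ 2 < inf D + e n.
  have [_ [y My <-] yn] := inf_adherent (e_gt0 n) Dinf; by exists y.
have Dle y : M y -> inf D <= `|x - y| ^+ 2.
  by move=> My; apply: ge_inf; [exact: Dinf.2 | exists y].
have half y z : M y -> M z -> M (2^-1 *: (y + z)).
  move=> My Mz; have Myz : M (y + z) by rewrite -(scale1r y); exact: Mlin.
  by rewrite -(addr0 (_ *: _)); exact: Mlin.
have uu n m : (n <= m)%N -> `|u n - u m| ^+ 2 <= 4 * e n.
  move=> nm; have [Mn un] := uP n; have [Mm um] := uP m.
  have := Dle _ (half _ _ Mn Mm); have := e_le _ _ nm.
  have -> : x - 2^-1 *: (u n + u m) = 2^-1 *: ((x - u n) + (x - u m)).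
    rewrite addrACA -opprD scalerBr (_ : x + x = 2 *: x); last by rewrite scaler_nat mulr2n.
    by rewrite scalerA mulVf ?pnatr_eq0// scale1r.
  have -> : u n - u m = (x - u m) - (x - u n) by rewrite opprB [RHS]addrC subrKA.
  rewrite normrZ exprMn ger0_norm ?invr_ge0// (normD_sqr (x - u n)) (normB_sqr (x - u m)).
  rewrite (innerC (x - u m)).
  move: un um; rewrite -/(e n) -/(e m).
  have -> : (2^-1 : R) ^+ 2 = 1 / 4 by field.
  by move=> h1 h2 h3 h4; lra.
have [||v uv] := @complete_seq R H u (fun n => 2 * Num.sqrt (e n)).
- move=> n m nm; rewrite -ler_sqr ?nnegrE ?mulr_ge0 ?sqrtr_ge0//.
  rewrite exprMn sqr_sqrtr; last exact/ltW.
  by rewrite (_ : 2 ^+ 2 = 4) ?uu//; ring.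
- rewrite -(mulr0 2); apply: cvgMr; rewrite -[X in _ --> X]sqrtr0.
  apply: continuous_cvg; [exact: sqrt_continuous | exact: cvg_harmonic].
exists v; first by exists u => // n; exact: (uP n).1.
move=> y My.
have key t : 0 <= t ^+ 2 * `|y| ^+ 2 - 2 * t * inner (x - v) y.
  pose w n := t ^+ 2 * `|y| ^+ 2 - 2 * t * inner (x - u n) y + e n.
  apply: (@seq_ge _ w) => [|n].
    rewrite /w -[X in _ --> X]addr0; apply: cvgD; last exact: cvg_harmonic.
    apply: cvgB; first exact: cvg_cst.
    apply: cvgMr; apply: cvg_innerl; apply: cvgB => //; exact: cvg_cst.
  have [Mn un] := uP n; have := Dle _ (Mlin t _ _ My Mn).
  have -> : x - (t *: y + u n) = (x - u n) - t *: y by rewrite opprD addrCA addrC.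
  rewrite normB_sqr normrZ exprMn real_normK ?num_real// innerZr /w.
  by move: un; rewrite -/(e n) => h1 h2; lra.
have [->|y0] := eqVneq y 0; first by rewrite inner0r.
have n0 : 0 < `|y| ^+ 2 by rewrite exprn_gt0// normr_gt0.
have := key (inner (x - v) y / `|y| ^+ 2); set c := inner _ _.
have -> : (c / `|y| ^+ 2) ^+ 2 * `|y| ^+ 2 - 2 * (c / `|y| ^+ 2) * c = - (c ^+ 2 / `|y| ^+ 2).
  by field; rewrite normr_eq0.
rewrite oppr_ge0 pmulr_lle0 ?invr_gt0// => c0.
by apply/eqP; rewrite -sqrf_eq0 eq_le c0 sqr_ge0.
Qed.

(** A vector orthogonal to the kernel of f represents f up to a factor. *)
Lemma riesz (f : H -> R) (k : R) : (forall c x y, f (c *: x + y) = c * f x + f y) ->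
  (forall x, `|f x| <= k * `|x|) -> exists z, forall x, f x = inner x z.
Proof.
move=> flin fk.
have f0 : f 0 = 0.
  by apply/eqP; rewrite -normr_eq0 eq_le normr_ge0 andbT (le_trans (fk 0))// normr0 mulr0.
have [fz|] := pselect (forall x, f x = 0).
  by exists 0 => x; rewrite inner0r fz.
move=> /existsNP[x /eqP fx].
have [|v [u fu uv] xv] := @projection (fun y => f y = 0) x f0.
  by move=> c y z fy fz; rewrite flin fy fz mulr0 addr0.
have fv : f v = 0.
  apply/eqP; rewrite -normr_eq0 eq_le normr_ge0 andbT.
  have : (fun n => k * `|v - u n|) @ \oo --> 0.
    rewrite -(mulr0 k); apply: cvgMr; rewrite -(normr0 H) -(subrr v).
    by apply: cvg_norm; apply: cvgB => //; exact: cvg_cst.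
  move/seq_ge; apply => n; apply: le_trans (fk _).
  by rewrite addrC -scaleN1r flin fu mulr0 add0r.
pose w := x - v.
have fw : f w = f x by rewrite /w addrC -scaleN1r flin fv mulr0 add0r.
have w0 : inner w w != 0.
  rewrite innerxx expf_eq0 normr_eq0; apply: contra fx => /eqP wE.
  by rewrite -fw wE f0.
exists ((f w / inner w w) *: w) => y; rewrite innerZr.
have : inner w (y - (f y / f w) *: w) = 0.
  apply: xv; rewrite addrC -scaleNr flin fw mulNr divfK ?addNr//.
rewrite innerBr innerZr (innerC w y) => /eqP; rewrite subr_eq0 => /eqP ->.
have fw0 : f w != 0 by rewrite fw.
by field; rewrite fw0 w0.
Qed.

(** The bound by a sum of squares is what pointwise comparison of forms gives;
    rescaling x and y to unit vectors makes it a bound by a product, at the cost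
    of the factor 2. *)
Lemma form_operator (b : H -> H -> R) (M : R) : 0 <= M ->
  (forall c x y z, b (c *: x + y) z = c * b x z + b y z) ->
  (forall x y, b x y = b y x) ->
  (forall x y, `|b x y| <= M * (`|x| ^+ 2 + `|y| ^+ 2)) ->
  exists2 B : Bh H, (forall x y, inner (B x) y = b x y) & `|B| <= 2 * M.
Proof.
move=> M0 blin bC bM.
have b0 y : b 0 y = 0.
  by have := blin 1 0 0 y; rewrite scale1r addr0 mul1r; lra.
have bZ c x y : b (c *: x) y = c * b x y by rewrite -[c *: x]addr0 blin b0 addr0.
have bd x y : `|b x y| <= 2 * M * `|x| * `|y|.
  have [->|x0] := eqVneq x 0; first by rewrite b0 !normr0 mulr0 mul0r.
  have [->|y0] := eqVneq y 0; first by rewrite bC b0 !normr0 mulr0.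
  have nx : 0 < `|x| by rewrite normr_gt0.
  have ny : 0 < `|y| by rewrite normr_gt0.
  have := bM (`|x|^-1 *: x) (`|y|^-1 *: y).
  rewrite !normrZ !normfV !normr_id !mulVf ?gt_eqF// bZ bC bZ bC !normrM !normfV.
  rewrite !normr_id expr1n mulrA -invfM mulrC ler_pdivrMr ?mulr_gt0//.
  by move=> h; apply: le_trans h _; rewrite le_eqVlt; apply/orP; left; apply/eqP; ring.
have /choice[B BP] x : exists z, forall y, b x y = inner y z.
  apply: (@riesz _ (2 * M * `|x|)) => [c y z|y]; last exact: bd.
  by rewrite !(bC x) blin.
have Bn x : `|B x| <= 2 * M * `|x|.
  have [->|B0] := eqVneq (B x) 0; first by rewrite normr0 !mulr_ge0.
  have := bd x (B x); rewrite BP innerxx normrX normr_id expr2.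
  by rewrite ler_pM2r// normr_gt0.
have Bs : B \in @selfadjoint R H.
  apply/asboolP; split.
  - by move=> c x y; apply: inner_nondeg => z; rewrite innerDZl !(innerC _ z) -!BP blin.
  - by exists (2 * M).
  - by move=> x y; rewrite innerC -!BP bC.
exists (MkBh Bs) => [x y|]; first by rewrite innerC -BP.
rewrite Bh_normE; apply: opnorm_lub => x x1 /=; apply: le_trans (Bn x) _.
by rewrite ler_piMr// mulr_ge0.
Qed.
End Projection.

Section Bh.
Context {R : realType} {H : hilbertType R}.
Implicit Types (x y z : H) (A B : Bh H).

Lemma BhDE A B x : (A + B) x = A x + B x. Proof. by []. Qed.
Lemma BhZE c A x : (c *: A) x = c *: A x. Proof. by []. Qed.
Lemma BhBE A B x : (A - B) x = A x - B x. Proof. by []. Qed.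
Lemma Bh0E x : (0 : Bh H) x = 0. Proof. by []. Qed.

Lemma Bh_sym A x y : inner (A x) y = inner x (A y).
Proof. by have [] := BhP A. Qed.

Lemma Bh_linear A : linear A. Proof. by have [] := BhP A. Qed.
HB.instance Definition _ A := GRing.isLinear.Build R H H *:%R A (Bh_linear A).

Lemma BhDr A x y : A (x + y) = A x + A y. Proof. exact: linearD. Qed.
Lemma BhBr A x y : A (x - y) = A x - A y. Proof. exact: linearB. Qed.
Lemma BhZr A c x : A (c *: x) = c *: A x. Proof. exact: linearZ. Qed.

Lemma opnorm_le A x : `|A x| <= `|A| * `|x|.
Proof.
have [->|x0] := eqVneq x 0; first by rewrite linear0 !normr0 mulr0.
have nx : 0 < `|x| by rewrite normr_gt0.
have := @opnorm_ub _ _ A (`|x|^-1 *: x).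
rewrite linearZ/= !normrZ normfV normr_id mulVf ?gt_eqF// => /(_ (lexx _)).
by rewrite mulrC ler_pdivrMr.
Qed.

Lemma inner_Bh_le A x y : `|inner (A x) y| <= `|A| * (`|x| ^+ 2 + `|y| ^+ 2).
Proof.
apply: le_trans (cauchy_schwarz _ _) _.
apply: (@le_trans _ _ (`|A| * (`|x| * `|y|))).
  by rewrite mulrA ler_wpM2r// opnorm_le.
rewrite ler_wpM2l//.
by have := sqr_ge0 (`|x| - `|y|); have := sqr_ge0 (`|x| + `|y|); lra.
Qed.

(** Polarization. *)
Lemma Bh_eq A B : (forall x, inner (A x) x = inner (B x) x) -> A = B.
Proof.
move=> AB; apply/val_inj/funext => x /=; apply: inner_nondeg => y.
have := AB (x + y); rewrite !linearD/= !innerDl !innerDr (AB x) (AB y).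
by rewrite (Bh_sym A y x) (Bh_sym B y x) !(innerC y); lra.
Qed.

Lemma Bh_id_subproof : (@id H) \in @selfadjoint R H.
Proof. by apply/asboolP; split => //; exists 1 => x; rewrite mul1r. Qed.

Definition Bh_id : Bh H := MkBh Bh_id_subproof.
End Bh.
(** * Positive and negative parts of a self-adjoint operator *)

Section Parts.
Context {R : realType} {H : hilbertType R}.
Implicit Types (x y z : H) (A B : Bh H).

Lemma cvg_Bh A (u : nat -> H) (l : H) :
  u @ \oo --> l -> (fun n => A (u n)) @ \oo --> A l.
Proof.
move=> ul; apply/cvgrPdist_lt => _/posnumP[d].
have y0 : 0 < 1 + `|A| by rewrite ltr_wpDr.
have /cvgrPdist_lt/(_ (d%:num / (1 + `|A|))) := ul.
case=> [|N _ uN]; first exact: divr_gt0.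
exists N => // n /= Nn; rewrite -linearB; apply: le_lt_trans (opnorm_le _ _) _.
have := uN n Nn; rewrite /= ltr_pdivlMr// mulrC; apply: le_lt_trans.
by rewrite ler_wpM2r// lerDr.
Qed.

Lemma limit_unique (u : nat -> H) (l m : H) : u @ \oo --> l -> u @ \oo --> m -> l = m.
Proof. by move=> ul um; apply: (cvg_unique (@norm_hausdorff _ H) ul um). Qed.

Lemma Bh_limit (Y : nat -> Bh H) (k : R) : (forall n, `|Y n| <= k) ->
  (forall x, exists l : H, (fun n => Y n x) @ \oo --> l) ->
  exists2 L : Bh H, (forall x, (fun n => Y n x) @ \oo --> L x) & `|L| <= k.
Proof.
move=> Yk /choice[L YL].
have k0 : 0 <= k by apply: le_trans (Yk 0).
have Ln x : `|L x| <= k * `|x|.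
  have : (fun n => k * `|x| - `|Y n x|) @ \oo --> k * `|x| - `|L x|.
    by apply: cvgB; [exact: cvg_cst | apply: cvg_norm; exact: YL].
  move/seq_ge => h; rewrite -subr_ge0; apply: h => n; rewrite subr_ge0.
  by apply: le_trans (opnorm_le _ _) _; rewrite ler_wpM2r.
have Ls : L \in @selfadjoint R H.
  apply/asboolP; split.
  - move=> c x y; apply: (limit_unique (YL _)).
    rewrite (_ : (fun n => _) = fun n => c *: Y n x + Y n y); last first.
      by apply/funext => n; rewrite linearP.
    by apply: cvgD; [apply: cvgZr|]; exact: YL.
  - by exists k.
  - move=> x y; rewrite (innerC x).
    have h1 := @cvg_innerl _ _ _ _ y (YL x); have h2 := @cvg_innerl _ _ _ _ x (YL y).
    have e : (fun n => inner (Y n x) y) = (fun n => inner (Y n y) x).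
      by apply/funext => n; rewrite Bh_sym innerC.
    rewrite e in h1; exact: (cvg_unique (@norm_hausdorff _ R^o) h1 h2).
exists (MkBh Ls) => //; rewrite Bh_normE; apply: opnorm_lub => x x1 /=.
by apply: le_trans (Ln x) _; rewrite ler_piMr.
Qed.

Lemma Bh_sq_subproof A : (A \o A) \in @selfadjoint R H.
Proof.
apply/asboolP; split; first by move=> c x y /=; rewrite !linearP.
- exists (`|A| * `|A|) => x; apply: le_trans (opnorm_le _ _) _.
  by rewrite -mulrA ler_wpM2l// opnorm_le.
- by move=> x y /=; rewrite !Bh_sym.
Qed.

Definition Bh_sq A : Bh H := MkBh (Bh_sq_subproof A).

(** If s is the limit of the iteration y |-> (1 - t^2 + y^2) / 2 from 0, then
    (1 - s)^2 = t^2.  The norms of the increments of the operator iteration [Y]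
    are dominated by the increments of the scalar iteration [y] at t = 0, which
    is monotone and bounded by 1. *)
Section SquareRoot.
Variable A : Bh H.
Hypothesis A1 : `|A| <= 1.

Let Z : Bh H := Bh_id - Bh_sq A.

Let step (Y : Bh H) : Bh H := 2^-1 *: (Z + Bh_sq Y).
Let Y n : Bh H := iter n step 0.
Let y n : R := iter n (fun t => (1 + t ^+ 2) / 2) 0.

Let YS n x : Y n.+1 x = 2^-1 *: (x - A (A x) + Y n (Y n x)).
Proof. by []. Qed.

Let yS n : y n.+1 = (1 + y n ^+ 2) / 2. Proof. by []. Qed.

Let y01 n : 0 <= y n <= 1.
Proof.
elim: n => [|n /andP[h1 h2]]; first by rewrite lexx ler01.
have h3 : y n ^+ 2 <= 1 by rewrite expr_le1.
by rewrite yS; have := sqr_ge0 (y n); lra.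
Qed.

Let y_nd n : y n <= y n.+1.
Proof. by rewrite yS; have := sqr_ge0 (1 - y n); lra. Qed.

Let A_le x : `|A x| <= `|x|.
Proof. by apply: le_trans (opnorm_le _ _) _; rewrite ler_piMl. Qed.

Let Z_le x : `|x - A (A x)| <= `|x|.
Proof.
rewrite -ler_sqr ?nnegrE// normB_sqr.
rewrite (innerC x) Bh_sym innerxx.
have : `|A (A x)| ^+ 2 <= `|A x| ^+ 2 by rewrite ler_sqr ?nnegrE.
have := sqr_ge0 `|A x|; lra.
Qed.

Let Y_le n x : `|Y n x| <= y n * `|x|.
Proof.
elim: n x => [|n IH] x; first by rewrite mul0r Bh0E normr0.
have -> : y n.+1 * `|x| = 2^-1 * (`|x| + y n * (y n * `|x|)) by rewrite yS; field.
rewrite YS normrZ ger0_norm ?invr_ge0// ler_wpM2l ?invr_ge0//.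
apply: le_trans (ler_normD _ _) _; rewrite lerD//.
by apply: le_trans (IH _) _; rewrite ler_wpM2l//; have /andP[] := y01 n.
Qed.

Let Y_step n x : `|Y n.+1 x - Y n x| <= (y n.+1 - y n) * `|x|.
Proof.
elim: n x => [|n IH] x.
  rewrite Bh0E !subr0 (_ : y 1 = 1 / 2 * 1); last by rewrite yS expr0n/= addr0 mulr1.
  rewrite YS Bh0E addr0 normrZ ger0_norm ?invr_ge0// mulr1 mul1r.
  by rewrite ler_wpM2l ?invr_ge0.
(* Y' Y' - Y Y = Y' (Y' - Y) + (Y' - Y) Y also for operators. *)
have -> : Y n.+2 x - Y n.+1 x =
    2^-1 *: (Y n.+1 (Y n.+1 x - Y n x) + (Y n.+1 (Y n x) - Y n (Y n x))).
  rewrite [Y n.+2 x]YS [X in _ - X = _]YS -scalerBr opprD addrACA subrr add0r.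
  by rewrite BhBr addrA subrK.
have -> : y n.+2 - y n.+1 = 2^-1 * (y n.+1 * (y n.+1 - y n) + (y n.+1 - y n) * y n).
  by rewrite (yS n.+1) {2}(yS n); field.
rewrite normrZ ger0_norm ?invr_ge0// -mulrA ler_wpM2l ?invr_ge0// mulrDl.
have /andP[y0 _] := y01 n.+1; have /andP[y1 _] := y01 n.
apply: le_trans (ler_normD _ _) _; apply: lerD.
  by apply: le_trans (Y_le _ _) _; rewrite -mulrA ler_wpM2l.
apply: le_trans (IH _) _; rewrite -mulrA ler_wpM2l ?subr_ge0//.
Qed.

Let Y_dist n m x : (n <= m)%N -> `|Y n x - Y m x| <= (y m - y n) * `|x|.
Proof.
elim: m => [|m IH]; first by rewrite leqn0 => /eqP ->; rewrite !subrr normr0 mul0r.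
rewrite leq_eqVlt => /orP[/eqP ->|]; first by rewrite !subrr normr0 mul0r.
rewrite ltnS => /IH {}IH; rewrite -(subrKA (Y m x)).
apply: le_trans (ler_normD _ _) _.
have -> : y m.+1 - y n = (y m - y n) + (y m.+1 - y m) by ring.
by rewrite mulrDl lerD// distrC Y_step.
Qed.

Let Y_comm n x : Y n (A x) = A (Y n x).
Proof.
elim: n x => [|n IH] x; first by rewrite !Bh0E linear0.
by rewrite !YS !IH BhZr BhDr BhBr.
Qed.

(** With L the limit of Y, the equation L = (1 - A^2 + L^2) / 2 says that
    (1 - L)^2 = A^2, and 1 - L is positive because L is a contraction. *)
Lemma abs_contraction : exists S : Bh H,
  [/\ psd S, forall x, S (S x) = A (A x) & forall x, S (A x) = A (S x)].
Proof.
have ycv : y @ \oo --> sup (range y).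
  apply: nondecreasing_cvgn; first by apply/nondecreasing_seqP.
  by exists 1 => _ [n _ <-]; have /andP[] := y01 n.
have yl n : y n <= sup (range y).
  apply: ub_le_sup; last by exists n.
  by exists 1 => _ [m _ <-]; have /andP[] := y01 m.
have [||L YL L1] := @Bh_limit Y 1.
- move=> n; rewrite Bh_normE; apply: opnorm_lub => x x1.
  have /andP[y0 y1] := y01 n.
  by apply: le_trans (Y_le _ _) _; rewrite mulr_ile1.
- move=> x; apply: (complete_seq (e := fun n => (sup (range y) - y n) * `|x|)).
    by move=> n m /(Y_dist x)/le_trans; apply; rewrite ler_wpM2r// lerB.
  rewrite -(mul0r `|x|) -(subrr (sup (range y))).
  by apply: cvgMl; apply: cvgB => //; exact: cvg_cst.
have LL x : L x = 2^-1 *: (x - A (A x) + L (L x)).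
  have h : (fun n => Y n.+1 x) @ \oo --> L x.
    by have := YL x; rewrite -cvg_shiftS.
  apply: (limit_unique h).
  rewrite (_ : (fun n => _) = fun n => 2^-1 *: (x - A (A x) +
      (Y n (Y n x - L x) + Y n (L x)))); last first.
    by apply/funext => n; rewrite YS BhBr subrK.
  apply: cvgZr; apply: cvgD; first exact: cvg_cst.
  rewrite -[X in _ --> X]add0r; apply: cvgD; last exact: YL.
  apply/cvgrPdist_lt => _/posnumP[d].
  have /cvgrPdist_lt/(_ d%:num)[//|N _ YN] := YL x.
  exists N => // n /= Nn; rewrite sub0r normrN; have := YN n Nn.
  rewrite /= distrC; apply: le_lt_trans; apply: le_trans (Y_le _ _) _.
  by have /andP[y0 y1] := y01 n; rewrite ler_piMl.
have LA x : L (A x) = A (L x).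
  apply: (limit_unique (YL _)); rewrite (_ : (fun n => _) = fun n => A (Y n x)).
    exact: cvg_Bh.
  by apply/funext => n; rewrite Y_comm.
exists (Bh_id - L); split.
- move=> x; rewrite BhBE innerBl innerxx subr_ge0.
  apply: le_trans (ler_norm _) _; apply: le_trans (cauchy_schwarz _ _) _.
  rewrite expr2 ler_wpM2r//; apply: le_trans (opnorm_le _ _) _.
  by rewrite ler_piMl.
- move=> x; rewrite !BhBE /= BhBr.
  have L2 : L x + L x = x - A (A x) + L (L x).
    rewrite -mulr2n -scaler_nat [in LHS]LL scalerA divff ?pnatr_eq0//.
    by rewrite scale1r.
  have -> : A (A x) = x + L (L x) - (L x + L x).
    by rewrite L2 [X in _ = _ - X]addrAC opprB [RHS]addrC subrK.
  by rewrite opprB addrACA -opprD.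
- by move=> x; rewrite !BhBE/= BhBr LA.
Qed.
End SquareRoot.

(** The form of U vanishes on the kernel of U; on the range of U it is
    <U U w, U w> = <U^3 w, w>, and every vector is approximated by a vector of the
    range up to one of the kernel. *)
Lemma psd_of_cube (U : Bh H) : (forall x, 0 <= inner (U (U (U x))) x) -> psd U.
Proof.
move=> U3 x.
have [||v [u uM uv] xv] := @projection _ _ (range U) x.
- by exists 0 => //; rewrite linear0.
- by move=> c _ _ [y _ <-] [z _ <-]; exists (c *: y + z) => //; rewrite linearP.
have /choice[w uw] n : exists y, U y = u n by have [y _ <-] := uM n; exists y.
have Uxv : U x = U v.
  apply/eqP; rewrite -subr_eq0 -linearB; apply/eqP; apply: inner_nondeg => z.
  by rewrite Bh_sym xv ?inner0l//; exists z.
rewrite Uxv Bh_sym Uxv -Bh_sym.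
have [r rE] : exists r : nat -> H, r = fun n => v - u n by eexists.
have r0 : r @ \oo --> (0 : H).
  by rewrite rE -(subrr v); apply: cvgB => //; exact: cvg_cst.
have nr0 : (fun n => `|r n|) @ \oo --> (0 : R).
  by rewrite -(normr0 H); exact: cvg_norm.
have h1 : (fun n => 2 * inner (r n) (U v)) @ \oo --> 2 * inner (0 : H) (U v).
  by apply: cvgMr; exact: cvg_innerl.
have h2 : (fun n => `|U| * (2 * (`|r n| * `|r n|))) @ \oo --> `|U| * (2 * (0 * 0)).
  by apply: cvgMr; apply: cvgMr; apply: cvgM.
have h : (fun n => inner (U v) v - 2 * inner (r n) (U v) +
    `|U| * (2 * (`|r n| * `|r n|))) @ \oo -->
    inner (U v) v - 2 * inner (0 : H) (U v) + `|U| * (2 * (0 * 0)).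
  by apply: cvgD => //; apply: cvgB => //; exact: cvg_cst.
rewrite inner0l !mulr0 subr0 addr0 in h; apply: (seq_ge h).
move=> n; have := inner_Bh_le U (r n) (r n); have := U3 (w n).
have uE := uw n; have -> : inner (U (U (U (w n)))) (w n) = inner (U (u n)) (u n).
  by rewrite uE Bh_sym uE.
have -> : u n = v - r n by rewrite rE subKr.
rewrite BhBr innerBl !innerBr (innerC (r n) (U v)) (Bh_sym _ (r n) v) (innerC (r n)).
rewrite ler_norml => ge0 /andP[lb ub]; lra.
Qed.

(** With S = |A|, U = S - A and V = S + A one has U V = V U = 0 and U + V = 2 S,
    so that U^3 = U (2 S) U is positive, and hence U is; likewise V. *)
Lemma pos_neg_parts_exists A : exists PN, pos_neg_parts A PN.
Proof.
have [A0|A0] := eqVneq A 0.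
  exists (0, 0); rewrite A0; split => //=; rewrite ?subr0// => x; rewrite ?Bh0E ?inner0l//.
have nA : 0 < `|A| by rewrite normr_gt0.
have [|S0 [S0p S0sq S0A]] := @abs_contraction (`|A|^-1 *: A).
  by rewrite normrZ normfV normr_id mulVf ?gt_eqF.
pose S := `|A| *: S0.
have Ssq x : S (S x) = A (A x).
  rewrite /S !BhZE BhZr S0sq !BhZE BhZr !scalerA.
  by rewrite [X in X *: _](_ : _ = 1) ?scale1r//; field; rewrite gt_eqF.
have SA x : S (A x) = A (S x).
  by have := S0A x; rewrite /S !BhZE !BhZr => /scalerI ->//; rewrite invr_neq0// gt_eqF.
have Sp : psd S by move=> x; rewrite BhZE innerZl mulr_ge0.
pose U := S - A; pose V := S + A.
have UV x : U (V x) = 0.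
  by rewrite /U /V BhBE BhDE !BhDr Ssq SA opprD (addrC (- _)) addrACA subrr addrC subrr addr0.
have VU x : V (U x) = 0.
  by rewrite /U /V BhDE BhBE !BhBr Ssq SA addrC subrKA subrr.
have Up : psd U.
  apply: psd_of_cube => x.
  have -> : U (U (U x)) = U (2 *: S (U x)).
    rewrite (_ : 2 *: S (U x) = U (U x) + V (U x)).
      by rewrite VU addr0.
    by rewrite {1}/U BhBE /V BhDE addrACA addNr addr0 -mulr2n scaler_nat.
  by rewrite Bh_sym innerZl mulr_ge0.
have Vp : psd V.
  apply: psd_of_cube => x.
  have -> : V (V (V x)) = V (2 *: S (V x)).
    rewrite (_ : 2 *: S (V x) = U (V x) + V (V x)).
      by rewrite UV add0r.
    by rewrite {1}/U BhBE {4}/V BhDE addrACA addNr addr0 -mulr2n scaler_nat.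
  by rewrite Bh_sym innerZl mulr_ge0.
exists (2^-1 *: V, 2^-1 *: U); split => /=.
- by move=> x; rewrite BhZE innerZl mulr_ge0 ?invr_ge0.
- by move=> x; rewrite BhZE innerZl mulr_ge0 ?invr_ge0.
- rewrite -scalerBr /U /V opprB [X in _ *: X]addrC addrA subrK -mulr2n -(scaler_nat 2 A) scalerA.
  by rewrite mulVf ?pnatr_eq0// scale1r.
- by move=> x; rewrite -[LHS]/(2^-1 *: V (2^-1 *: U x)) BhZr VU !scaler0.
- by move=> x; rewrite -[LHS]/(2^-1 *: U (2^-1 *: V x)) BhZr UV !scaler0.
Qed.

Lemma posnegP A : pos_neg_parts A (posneg A).
Proof. by apply: xgetPex; exact: pos_neg_parts_exists. Qed.

End Parts.
(** * Complete positivity as positivity of a scalar functional *)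

Section Orthonormal.
Context {R : realType} {K : hilbertType R}.

Lemma gram_schmidt (s : seq K) : exists (n : nat) (e : 'I_n -> K),
  (forall i j, inner (e i) (e j) = (i == j)%:R) /\
  (forall x, x \in s -> x = \sum_i inner x (e i) *: e i).
Proof.
elim: s => [|x s [n [e [ee se]]]].
  by exists 0, (fun=> 0); split => [[]|x].
pose r := x - \sum_i inner x (e i) *: e i.
have re i : inner r (e i) = 0.
  rewrite innerBl inner_suml (bigD1 i)//= innerZl ee eqxx mulr1 big1 ?addr0 ?subrr//.
  by move=> j ji; rewrite innerZl ee (negbTE ji) mulr0.
have [r0|r0] := eqVneq r 0.
  exists n, e; split => // y; rewrite in_cons => /orP[/eqP ->|/se//].
  by apply/eqP; rewrite -subr_eq0; apply/eqP.
have nr : `|r| != 0 by rewrite normr_eq0.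
pose f (i : 'I_n.+1) := if unlift ord0 i is Some j then e j else `|r|^-1 *: r.
have f0 : f ord0 = `|r|^-1 *: r by rewrite /f unlift_none.
have fS i : f (lift ord0 i) = e i by rewrite /f liftK.
exists n.+1, f; split => [i j|y].
  case: (unliftP ord0 i) => [i' ->|->]; case: (unliftP ord0 j) => [j' ->|->].
  - by rewrite !fS ee (inj_eq lift_inj).
  - by rewrite fS f0 innerZr innerC re mulr0 eq_sym (negbTE (neq_lift _ _)).
  - by rewrite fS f0 innerZl re mulr0 (negbTE (neq_lift _ _)).
  - by rewrite f0 innerZl innerZr innerxx eqxx mulr1n; field.
rewrite in_cons big_ord_recl; under eq_bigr do rewrite fS.
rewrite f0 innerZr scalerA => /orP[/eqP ->|ys].
  have -> : inner x r = `|r| ^+ 2.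
    rewrite -innerxx {2}/r innerBl inner_suml big1 ?subr0// => i _.
    by rewrite innerZl (innerC _ r) re mulr0.
  rewrite (_ : _ * _ = 1) ?scale1r ?subrK//; by field.
have -> : inner y r = 0.
  by rewrite (se _ ys) inner_suml big1// => i _; rewrite innerZl (innerC _ r) re mulr0.
by rewrite mulr0 mul0r scale0r add0r -se.
Qed.

Definition coord_map (H : lmodType R) (n : nat) (e : 'I_n -> K) (h : 'I_n -> H)
  (x : K) : H := \sum_i inner x (e i) *: h i.

Lemma coord_map_linear (H : lmodType R) n (e : 'I_n -> K) (h : 'I_n -> H) :
  linear (coord_map e h).
Proof.
move=> c x y; rewrite /coord_map scaler_sumr -big_split/=.
by apply: eq_bigr => i _; rewrite innerDZl scalerDl scalerA.
Qed.

HB.instance Definition _ (H : lmodType R) n (e : 'I_n -> K) (h : 'I_n -> H) :=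
  GRing.isLinear.Build R K H *:%R (coord_map e h) (coord_map_linear e h).

End Orthonormal.

Lemma Bh_sumE {R : realType} {V : hilbertType R} I (s : seq I) (B : I -> Bh V) x :
  (\sum_(i <- s) B i) x = \sum_(i <- s) B i x.
Proof. by elim/big_rec2: _ => // i y z _ <-. Qed.

(** The block matrix with entries \sum_i c_ij c_il B_i, evaluated at the vectors
    h_l, is the sum of the quadratic forms of the B_i at the combinations of the
    h_l with coefficients c_il.  It is used once on H and once on K. *)
Lemma block_form {R : realType} {V : hilbertType R} I (s : seq I) (B : I -> Bh V)
    n (c : I -> 'I_n -> R) (h : 'I_n -> V) :
  \sum_j inner (\sum_l (\sum_(i <- s) (c i j * c i l) *: B i) (h l)) (h j) =
  \sum_(i <- s) inner (B i (\sum_l c i l *: h l)) (\sum_l c i l *: h l).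
Proof.
under eq_bigr => j _.
  under eq_bigr do rewrite Bh_sumE.
  rewrite exchange_big/= inner_suml.
  over.
rewrite exchange_big/=; apply: eq_bigr => i _.
rewrite inner_sumr; apply: eq_bigr => j _.
rewrite linear_sum !inner_suml; apply: eq_bigr => l _.
rewrite -[LHS]/(inner ((c i j * c i l) *: (B i (h l))) (h j)) linearZ/= !innerZl innerZr.
by ring.
Qed.

Section Veval.
Context {R : realType} (d : nat) (V : lmodType R).
Implicit Types (F G : vpoly d V) (a : 'I_d -> R).

Lemma veval_linear a : linear (@veval R d V a).
Proof.
move=> c F G.
pose S := fset_set ([set k | F k != 0] `|` [set k | G k != 0]).
have SE k : (k \in S) = (F k != 0) || (G k != 0).
  rewrite in_fset_set; last by rewrite finite_setU; split; exact: vpoly_finite.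
  by apply/idP/orP; rewrite inE.
have vE (E : vpoly d V) : (forall k, k \notin S -> E k = 0) ->
    veval a E = \sum_(k <- S) mmap1 a k *: E k.
  move=> ES; rewrite /veval (fsbigTE S)// => k kS.
  by rewrite ES ?scaler0.
have F0 k : k \notin S -> F k = 0 by rewrite SE negb_or !negbK => /andP[/eqP].
have G0 k : k \notin S -> G k = 0 by rewrite SE negb_or !negbK => /andP[_ /eqP].
have E k : (c *: F + G) k = c *: F k + G k by [].
rewrite !vE//; last by move=> k kS; rewrite E F0// G0// scaler0 addr0.
rewrite scaler_sumr -big_split/=; apply: eq_bigr => k _.
by rewrite scalerDr !scalerA mulrC.
Qed.

HB.instance Definition _ a :=
  GRing.isLinear.Build R (vpoly d V) V *:%R (@veval R d V a) (veval_linear a).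

End Veval.

Section CompletePositivity.
Context {R : realType} {H K : hilbertType R} {d : nat} (X : set 'rV[R]_d).
Variable L : {linear vpoly d (Bh H) -> Bh K}.

(** The tensor \sum F (x) x (x) x as a function of the point y.1 and of a linear
    map y.2 : K -> H.  A linear map amounts to a choice of vectors of H, one for
    each member of a basis of K, so matrix positivity of every size becomes
    pointwise positivity. *)
Definition quad (s : seq (vpoly d (Bh H) * K)) (y : 'rV[R]_d * {linear K -> H}) : R :=
  \sum_(Fx <- s) inner (veval (fun i => y.1 0 i) Fx.1 (y.2 Fx.2)) (y.2 Fx.2).

Definition quadL (s : seq (vpoly d (Bh H) * K)) : R :=
  \sum_(Fx <- s) inner (L Fx.1 Fx.2) Fx.2.

(** Expand the vectors x in an orthonormal basis e of their span.  The matrix G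
    of coefficients of the tensor is symmetric; its value at h in H^n is that of
    the function at the map T sending e_l to h_l, and the value of L(G) at e is
    that of the functional. *)
Lemma quadL_ge0 :
  (forall (n : nat) (G : 'M[vpoly d (Bh H)]_n),
    (forall j l, G j l = G l j) ->
    (forall a : 'rV[R]_d, X a ->
      block_psd (\matrix_(j, l) veval (fun i => a 0 i) (G j l))) ->
    block_psd (\matrix_(j, l) L (G j l))) ->
  forall s, (forall y, X y.1 -> 0 <= quad s y) -> 0 <= quadL s.
Proof.
move=> CP s s_ge0.
have [n [e [_ se]]] := gram_schmidt [seq Fx.2 | Fx <- s].
pose c (Fx : vpoly d (Bh H) * K) (i : 'I_n) := inner Fx.2 (e i).
pose G : 'M[vpoly d (Bh H)]_n :=
  \matrix_(j, l) \sum_(Fx <- s) (c Fx j * c Fx l) *: Fx.1.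
have := CP n G _ _ e.
have -> : \sum_j inner (\sum_l (\matrix_(j, l) L (G j l)) j l (e l)) (e j) = quadL s.
  transitivity (\sum_j inner (\sum_l (\sum_(Fx <- s) (c Fx j * c Fx l) *: L Fx.1) (e l)) (e j)).
    apply: eq_bigr => j _; congr inner; apply: eq_bigr => l _.
    rewrite !mxE linear_sum/=; congr (Bh_fun _ _).
    by apply: eq_bigr => Fx _; rewrite linearZ.
  rewrite (block_form _ (fun Fx => L Fx.1)) /quadL !big_seq.
  apply: eq_bigr => Fx Fxs; rewrite -(se Fx.2)//.
  exact: map_f.
apply=> [j l|a Xa h].
  by rewrite !mxE; apply: eq_bigr => Fx _; rewrite mulrC.
suff -> : \sum_j inner (\sum_l (\matrix_(j, l) veval (fun i => a 0 i) (G j l)) j l (h l)) (h j) =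
    quad s (a, (coord_map e h : {linear K -> H})) by exact: s_ge0.
transitivity (\sum_j inner (\sum_l (\sum_(Fx <- s) (c Fx j * c Fx l) *:
    veval (fun i => a 0 i) Fx.1) (h l)) (h j)).
  apply: eq_bigr => j _; congr inner; apply: eq_bigr => l _.
  rewrite !mxE linear_sum/=; congr (Bh_fun _ _).
  by apply: eq_bigr => Fx _; rewrite linearZ.
by rewrite (block_form _ (fun Fx => veval _ Fx.1)).
Qed.

End CompletePositivity.
(** * M. Riesz's extension theorem *)

Section MRiesz.
Context {R : realType} {V : lmodType R}.
Variable pos : set V.
Hypothesis pos0 : pos 0.
Hypothesis posD : forall u v, pos u -> pos v -> pos (u + v).
Hypothesis posZ : forall c u, 0 < c -> pos u -> pos (c *: u).
Variable W0 : set (V * R).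

(** A positive functional on a subspace, encoded by its graph: positivity makes
    the relation single-valued ([Wfun] below), and unions of chains of graphs
    are easy to form. *)
Definition pos_linrel (W : set (V * R)) :=
  [/\ W (0, 0), forall c u r v s, W (u, r) -> W (v, s) -> W (c *: u + v, c * r + s)
    & forall u r, W (u, r) -> pos u -> 0 <= r].

Hypothesis W0lin : pos_linrel W0.

Definition dominated (v : V) :=
  (exists w r, W0 (w, r) /\ pos (w - v)) /\ (exists w r, W0 (w, r) /\ pos (w + v)).
Local Notation dom := dominated.

(** Zorn's lemma gives a maximal positive extension W.  If a dominated vector v
    were outside its domain, the values s on vectors w below v would be bounded
    by the values on vectors above v, and W could be extended by sending v to
    the supremum c of the former. *)
Lemma riesz_extension : exists phi : V -> R,
  [/\ forall u r, W0 (u, r) -> phi u = r,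
      forall c u v, dom u -> dom v -> phi (c *: u + v) = c * phi u + phi v
    & forall u, dom u -> pos u -> 0 <= phi u].
Proof.
have [|W [[WE|[W0W Wlin]] Wmax]] := @Zorn_bigcup (V * R)%type
  (fun W => W = set0 \/ (W0 `<=` W /\ pos_linrel W)).
- move=> F FP Ftot.
  have [[A0 [FA0 A0n]]|Fe] := pselect (exists A, F A /\ A !=set0); last first.
    left; apply/seteqP; split => // p [A FA Ap]; apply: Fe; exists A; split => //.
    by exists p.
  right; have FW A : F A -> A !=set0 -> W0 `<=` A /\ pos_linrel A.
    by move=> FA [p Ap]; case: (FP _ FA) => // A_0; rewrite A_0 in Ap.
  have [W0A [A00 _ _]] := FW _ FA0 A0n.
  split; first by move=> p /W0A ?; exists A0.
  split; first by exists A0.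
  + move=> c u r v s [A FA Au] [B FB Bv].
    have [_ [_ Al _]] := FW _ FA (ex_intro _ _ Au).
    have [_ [_ Bl _]] := FW _ FB (ex_intro _ _ Bv).
    case: (Ftot _ _ FA FB) => [AB|BA].
      by exists B => //; apply: Bl => //; exact: AB.
    by exists A => //; apply: Al => //; exact: BA.
  + move=> u r [A FA Au]; have [_ [_ _ Ap]] := FW _ FA (ex_intro _ _ Au).
    exact: Ap.
- exfalso; apply: (Wmax W0); last by right; split.
  rewrite WE; split; first exact: sub0set.
  by move=> /(_ (0, 0)); case: W0lin => h _ _ /(_ h).
have [W00 Wl Wp] := Wlin.
have WN u r : W (u, r) -> W (- u, - r).
  by move=> Wu; have := Wl (-1) _ _ _ _ Wu W00; rewrite scaleN1r mulN1r !addr0.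
have WB u r v s : W (u, r) -> W (v, s) -> W (u - v, r - s).
  by move=> Wu /WN Wv; have := Wl 1 _ _ _ _ Wu Wv; rewrite scale1r mul1r.
(* pos contains 0 = u - u, so two values at u bound each other. *)
have Wfun u r s : W (u, r) -> W (u, s) -> r = s.
  move=> Wr Ws; have := Wp _ _ (WB _ _ _ _ Wr Ws); have := Wp _ _ (WB _ _ _ _ Ws Wr).
  rewrite subrr !subr_ge0 => /(_ pos0) sr /(_ pos0) rs.
  by apply/eqP; rewrite eq_le sr rs.
have Wdom v : dom v -> exists r, W (v, r).
  move=> [[w0 [r0 [/W0W Ww0 wv]]] [w1 [r1 [/W0W Ww1 wv']]]]; apply: contrapT => nv.
  have nW r : ~ W (v, r) by move=> ?; apply: nv; exists r.
  pose S := [set s | exists2 w, W (w, s) & pos (v - w)].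
  have Sub w s : W (w, s) -> pos (w - v) -> ubound S s.
    move=> Ww pw t [w' Ww' pw']; rewrite -subr_ge0; apply: Wp (WB _ _ _ _ Ww Ww') _.
    by rewrite -(subrKA v); exact: posD.
  have Sn : S !=set0 by exists (- r1), (- w1); [exact: WN | rewrite opprK addrC].
  pose c := sup S.
  have cge w s : W (w, s) -> pos (v - w) -> s <= c.
    by move=> Ww pw; apply: ub_le_sup; [exists r0; exact: (Sub w0) | exists w].
  have cle w s : W (w, s) -> pos (w - v) -> c <= s.
    by move=> Ww pw; apply: ge_sup => //; exact: (Sub w).
  pose W' := [set p : V * R | exists w s t, W (w, s) /\ p = (w + t *: v, s + t * c)].
  apply: (Wmax W').
    split => [[w s] Ww|].
      by exists w, s, 0; split=> //; rewrite scale0r mul0r !addr0.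
    move=> /(_ (v, c)) h; apply: (nW c); apply: h.
    by exists 0, 0, 1; split => //; rewrite scale1r mul1r !add0r.
  right; split.
    move=> [w s] /W0W Ww.
    by exists w, s, 0; split=> //; rewrite scale0r mul0r !addr0.
  split.
  - by exists 0, 0, 0; split=> //; rewrite scale0r mul0r !addr0.
  - move=> k _ _ _ _ [w [s [t [Ww [-> ->]]]]] [w' [s' [t' [Ww' [-> ->]]]]].
    exists (k *: w + w'), (k * s + s'), (k * t + t'); split; first exact: Wl.
    congr (_, _); last by ring.
    by rewrite scalerDr scalerDl !scalerA addrACA.
  - move=> _ _ [w [s [t [Ww [-> ->]]]]] pu.
    have WZ k : W (k *: w, k * s) by have := Wl k _ _ _ _ Ww W00; rewrite !addr0.
    case: (ltgtP t 0) => t0.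
    + have : c <= (- t)^-1 * s.
        apply: (cle _ _ (WZ _)); have -> : v = (- t)^-1 *: (- t *: v).
          by rewrite scalerA mulVf ?scale1r// oppr_eq0 lt_eqF.
        by rewrite -scalerBr scaleNr opprK; apply: posZ => //; rewrite invr_gt0 oppr_gt0.
      by rewrite mulrC ler_pdivlMr ?oppr_gt0//; lra.
    + have : - (t^-1) * s <= c.
        apply: (cge _ _ (WZ _)); have -> : v = t^-1 *: (t *: v).
          by rewrite scalerA mulVf ?scale1r// gt_eqF.
        rewrite scaleNr opprK -scalerDr addrC; apply: posZ => //.
        by rewrite invr_gt0.
      by rewrite mulNr mulrC -mulNr ler_pdivrMr//; lra.
    + by move: pu; rewrite t0 scale0r mul0r !addr0; exact: Wp Ww.
have /choice[phi phiP] v : exists r, (exists t, W (v, t)) -> W (v, r).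
  by have [[r Wr]|nd] := pselect (exists t, W (v, t)); [exists r | exists 0].
exists phi; split.
- by move=> u r /W0W Wu; apply: (@Wfun u) => //; apply: phiP; exists r.
- move=> c u v /Wdom/phiP Wu /Wdom/phiP Wv.
  have Wuv := Wl c _ _ _ _ Wu Wv.
  exact: Wfun (phiP _ (ex_intro _ _ Wuv)) Wuv.
- by move=> u /Wdom/phiP; exact: Wp.
Qed.

End MRiesz.
(** * Measures on spaces of ultrafilters *)

(** The points of the Stone-Cech compactification of the discrete space T. *)
Record stone (T : Type) := Stone {
  ultra_of : set_system T ;
  ultra_ofP : UltraFilter ultra_of }.

Arguments ultra_ofP {T}.

Definition principal (T : Type) (t : T) : stone T :=
  Stone (principal_filter_ultra t).

(** The sets [basic D] are the clopen sets of the Stone topology. *)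
Definition basic (T : Type) (D : set T) : set (stone T) := [set U | ultra_of U D].

Section StoneSets.
Context {T : Type}.
Implicit Types (A B D : set T) (U : stone T).

Lemma basicC D : basic (~` D) = ~` basic D.
Proof.
apply/seteqP; split => U /=; have UU := ultra_ofP U.
  by move=> nD UD; have : ultra_of U (D `&` ~` D) by [exact: filterI];
    rewrite setICr; exact: filter_not_empty.
by case: (in_ultra_setVsetC D UU).
Qed.

Lemma basic0 : basic (@set0 T) = set0.
Proof.
by apply/seteqP; split => // U /=; have UU := ultra_ofP U; exact: filter_not_empty.
Qed.

Lemma basicI A B : basic (A `&` B) = basic A `&` basic B.
Proof.
apply/seteqP; split => U /=; have UU := ultra_ofP U; last by case; exact: filterI.
by move=> UAB; split; apply: filterS UAB => t [].
Qed.

Lemma basicU A B : basic (A `|` B) = basic A `|` basic B.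
Proof. by rewrite -[LHS]setCK -basicC setCU basicI !basicC setCI !setCK. Qed.

Lemma basicT : basic [set: T] = setT.
Proof. by rewrite -setC0 basicC basic0 setC0. Qed.

Lemma basic_sub A B : A `<=` B -> basic A `<=` basic B.
Proof. by move=> AB U /=; have UU := ultra_ofP U; apply: filterS. Qed.

Lemma basic_bigcup_fin (E : nat -> set T) n :
  basic (\bigcup_(i in `I_n) E i) = \bigcup_(i in `I_n) basic (E i).
Proof.
elim: n => [|n IH]; first by rewrite II0 !bigcup_set0 basic0.
by rewrite IIS !bigcup_setU !bigcup_set1 basicU IH.
Qed.

Lemma principal_basic D : @principal T @^-1` basic D = D.
Proof. by apply/seteqP; split => t; rewrite /= principal_filterP. Qed.

(** Otherwise the sets D minus finitely many E i generate a proper filter, and an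
    ultrafilter finer than it contains D but none of the E i. *)
Lemma basic_compact D (E : nat -> set T) : basic D `<=` \bigcup_i basic (E i) ->
  exists N, D `<=` \bigcup_(i in `I_N) E i.
Proof.
move=> DE; apply: contrapT => /forallNP nN.
pose B N := D `\` \bigcup_(i in `I_N) E i.
pose F := [set A | exists N, B N `<=` A].
have FF : ProperFilter F.
  split.
    move=> [N BN]; apply: (nN N) => t Dt; apply: contrapT => nt; exact: (BN t).
  split.
  - by exists 0.
  - move=> P Q [n nP] [m mQ]; exists (maxn n m) => t [Dt nt].
    split; [apply: nP | apply: mQ]; split => // -[i /= i_lt Ei]; apply: nt; exists i => //=.
    + by rewrite (leq_trans i_lt) ?leq_maxl.
    + by rewrite (leq_trans i_lt) ?leq_maxr.
  - by move=> P Q PQ [n nP]; exists n; exact: subset_trans PQ.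
have [G [GU FG]] := ultraFilterLemma FF.
have GD : G D by apply: FG; exists 0 => t [].
have [i _ /= GE] := DE (Stone GU) GD.
have : G (E i `&` B i.+1) by apply: filterI => //; apply: FG; exists i.+1.
rewrite (_ : _ `&` _ = set0); first exact: filter_not_empty.
by apply/seteqP; split => // t [Et [_]]; apply; exists i => /=.
Qed.

End StoneSets.

HB.instance Definition _ (T : Type) := gen_eqMixin (stone T).
HB.instance Definition _ (T : Type) := gen_choiceMixin (stone T).
HB.instance Definition _ (T : pointedType) :=
  isPointed.Build (stone T) (principal point).

Section StoneAlgebra.
Context {T : pointedType}.

Let range0 : range (@basic T) set0.
Proof. by exists set0 => //; rewrite basic0. Qed.

Let rangeU : setU_closed (range (@basic T)).
Proof. by move=> _ _ [A _ <-] [B _ <-]; exists (A `|` B) => //; rewrite basicU. Qed.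

Let rangeC : setC_closed (range (@basic T)).
Proof. by move=> _ [A _ <-]; exists (~` A) => //; rewrite basicC. Qed.

HB.instance Definition _ := isAlgebraOfSets.Build default_measure_display
  (stone T) range0 rangeU rangeC.
End StoneAlgebra.

Notation stone_space T :=
  (g_sigma_algebraType (@measurable default_measure_display (stone T))).

Definition fin_additive {R : realType} (T : Type) (nu : set T -> R) :=
  (forall D, 0 <= nu D) /\
  (forall A B, A `&` B = set0 -> nu (A `|` B) = nu A + nu B).

Section FinAdditive.
Context {R : realType} (T : Type) (nu : set T -> R).
Hypothesis nuP : fin_additive nu.

Lemma fin_additive0 : nu set0 = 0.
Proof.
have [_ /(_ set0 set0)] := nuP; rewrite setI0 setU0 => /(_ erefl); lra.
Qed.

Lemma fin_additive_sum (E : nat -> set T) n : trivIset setT E ->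
  nu (\bigcup_(i in `I_n) E i) = \sum_(0 <= i < n) nu (E i).
Proof.
move=> tE; elim: n => [|n IH]; first by rewrite II0 bigcup_set0 big_geq// fin_additive0.
rewrite big_nat_recr//= -IH IIS bigcup_setU bigcup_set1; apply: nuP.2.
apply/seteqP; split => // t [[i /= i_n Ei] En].
by have := tE i n I I; rewrite -[i = n]/(i = n); move: i_n => /[swap] ->; [rewrite ltnn | exists t].
Qed.

Lemma fin_additive_le A B : A `<=` B -> nu A <= nu B.
Proof.
move=> AB; rewrite -(setDUK AB) nuP.2; last by rewrite setDE setICA setICr setI0.
by rewrite lerDl nuP.1.
Qed.

End FinAdditive.

Section StoneMeasure.
Context {R : realType} (T : pointedType) (nu : set T -> R).
Hypothesis nuP : fin_additive nu.

Let mu (S : set (stone T)) : \bar R := (nu (@principal T @^-1` S))%:E.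

Let mu_basic D : mu (basic D) = (nu D)%:E.
Proof. by rewrite /mu principal_basic. Qed.

Let mu0 : mu set0 = 0%E.
Proof. by rewrite /mu preimage_set0 fin_additive0. Qed.

Let mu_ge0 S : (0 <= mu S)%E.
Proof. by rewrite lee_fin nuP.1. Qed.

Let mu_sigma_additive : semi_sigma_additive mu.
Proof.
move=> F mF tF [D _ DF].
pose E i := @principal T @^-1` (F i).
have FE i : F i = basic (E i).
  by have [A _ AF] := mF i; rewrite /E -AF principal_basic.
have tE : trivIset setT E.
  by move=> i j _ _ [t [Ei Ej]]; apply: (tF i j) => //; exists (principal t).
have [|N DN] := @basic_compact T D E.
  by rewrite DF => U [i _]; rewrite FE => ?; exists i.
have ED i : E i `<=` D.
  rewrite -(principal_basic D) DF => t Eit; by exists i.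
rewrite -DF mu_basic; apply: cvg_near_cst; exists N => // n /= Nn.
under eq_bigr do rewrite FE mu_basic.
rewrite sumEFin -fin_additive_sum//; congr (nu _)%:E; apply/seteqP; split.
  by move=> t [i _]; exact: ED.
by move=> t /DN[i /= iN Ei]; exists i => //=; exact: leq_trans Nn.
Qed.

HB.instance Definition _ := isMeasure.Build default_measure_display (stone T) R mu
  mu0 mu_ge0 mu_sigma_additive.

(** By compactness, a basic set that is a disjoint union of countably many basic
    sets is a union of finitely many of them, so finite additivity is countable
    additivity on the algebra of basic sets.  The set function is defined on all
    sets by their traces on the principal ultrafilters. *)
Lemma stone_extension : exists M : {measure set (stone_space T) -> \bar R},
  forall D, M (basic D) = (nu D)%:E.
Proof.
exists (measure_extension mu) => D.
by rewrite -mu_basic; apply: (@measurable_mu_extE _ _ _ mu); exists D.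
Qed.

End StoneMeasure.

Lemma stone_measures {R : realType} (T : pointedType) :
  exists M : (set T -> R) -> {measure set (stone_space T) -> \bar R},
    (forall nu, M nu setT < +oo)%E /\
    (forall nu, fin_additive nu -> forall D, M nu (basic D) = (nu D)%:E).
Proof.
suff /choice[M MP] (nu : set T -> R) : exists M : {measure set (stone_space T) -> \bar R},
    (M setT < +oo)%E /\ (fin_additive nu -> forall D, M (basic D) = (nu D)%:E).
  by exists M; split => nu; have [] := MP nu.
have [/stone_extension[M MP]|n] := pselect (fin_additive nu); last first.
  by exists mzero; split => //; exact: ltry.
by exists M; split => //; rewrite -basicT MP ltry.
Qed.

(** The sets A on which the relation holds form a Dynkin system. *)
Lemma measure_relation {R : realType} d (T : measurableType d) (G : set (set T))
    (I : Type) (s : seq I) (c : I -> R) (m : I -> {measure set T -> \bar R}) :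
  @measurable _ T = <<s G >> -> setI_closed G -> (forall i, m i setT < +oo)%E ->
  G setT -> (forall A, G A -> \sum_(i <- s) c i * fine (m i A) = 0) ->
  forall A, measurable A -> \sum_(i <- s) c i * fine (m i A) = 0.
Proof.
move=> GE GI mfin GT Gs A; rewrite {1}GE; move: A.
have mf i A : measurable A -> m i A \is a fin_num.
  move=> mA; rewrite ge0_fin_numE//; apply: le_lt_trans (mfin i).
  by apply: le_measure; rewrite ?inE.
apply: (dynkin_induction (P := [set A | \sum_(i <- s) c i * fine (m i A) = 0]) GE GI) => /=.
- exact: Gs.
- by move=> A; exact: Gs.
- move=> S mS S0; rewrite -[RHS](Gs _ GT) -[RHS]subr0 -[X in _ = _ - X]S0 -sumrB.
  apply: eq_bigr => i _; rewrite -mulrBr; congr (_ * _).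
  apply/eqP; rewrite eq_sym subr_eq -fineD ?mf//; last exact: measurableC.
  rewrite -measureU//; [by rewrite setvU | exact: measurableC |].
  by rewrite setICl.
- move=> F mF tF F0.
  have mU : measurable (\bigcup_k F k) by exact: bigcupT_measurable.
  have h i : (fun n => \sum_(0 <= k < n) fine (m i (F k))) @ \oo --> fine (m i (\bigcup_k F k)).
    have := @measure_semi_sigma_additive _ _ _ (m i) F mF tF mU.
    rewrite -[X in _ --> X](fineK (mf i _ mU)) => /fine_cvg.
    rewrite (_ : fine \o _ = fun n => \sum_(0 <= k < n) fine (m i (F k)))//.
    by apply/funext => n /=; rewrite sum_fine// => k _; exact: mf.
  have : (fun n => \sum_(i <- s) c i * \sum_(0 <= k < n) fine (m i (F k))) @ \oo -->
      \sum_(i <- s) c i * fine (m i (\bigcup_k F k)).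
    apply: (@cvg_big R I +%R 0 xpredT (@add_continuous R) _ \oo) => i _.
    exact: cvgMr.
  rewrite (_ : (fun n => _) = cst 0); last first.
    apply/funext => n; under eq_bigr do rewrite mulr_sumr.
    by rewrite exchange_big/= big1.
  by move=> /(cvg_unique (@norm_hausdorff _ R^o)) => /(_ 0 (cvg_cst _)).
Qed.
(** * Linearity of the passage to measures *)

Section SignedExtension.
Context {R : realType} (T : pointedType).

(** The finitely additive functions of bounded variation. *)
Definition fin_jordan (lam : set T -> R) := exists nu : (set T -> R) * (set T -> R),
  [/\ fin_additive nu.1, fin_additive nu.2 & forall D, lam D = nu.1 D - nu.2 D].

Lemma fin_additive_jordan nu : fin_additive nu -> fin_jordan nu.
Proof.
move=> nuP; exists (nu, cst 0); split => //= [|D]; last by rewrite subr0.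
by split => // A B _; rewrite /cst addr0.
Qed.

(** An arbitrary decomposition lam = nu1 - nu2 may be used to extend lam: by
    [measure_relation] the result does not depend on it and is linear in lam. *)
Lemma signed_extension (M : (set T -> R) -> {measure set (stone_space T) -> \bar R}) :
  (forall nu, M nu setT < +oo)%E ->
  (forall nu, fin_additive nu -> forall D, M nu (basic D) = (nu D)%:E) ->
  exists ext : (set T -> R) -> set (stone_space T) -> R,
    (forall c lam lam' lam'', fin_jordan lam -> fin_jordan lam' -> fin_jordan lam'' ->
      (forall D, lam'' D = c * lam D + lam' D) ->
      forall S, measurable S -> ext lam'' S = c * ext lam S + ext lam' S) /\
    (forall nu, fin_additive nu -> forall S, measurable S -> ext nu S = fine (M nu S)).
Proof.
move=> Mfin MP.
have rel (s : seq (R * (set T -> R))) :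
    (forall p, List.In p s -> fin_additive p.2) ->
    (forall D, \sum_(p <- s) p.1 * p.2 D = 0) ->
    forall S, measurable S -> \sum_(p <- s) p.1 * fine (M p.2 S) = 0.
  move=> sP s0; apply: (@measure_relation _ _ (stone_space T) (range (@basic T))) => //.
  - by move=> _ _ [A _ <-] [B _ <-]; exists (A `&` B) => //; rewrite basicI.
  - by exists setT => //; rewrite basicT.
  - move=> _ [D _ <-]; rewrite -[RHS](s0 D).
    elim: s {s0} sP => [|p s IH] sP; first by rewrite !big_nil.
    rewrite !big_cons IH; last by move=> q qs; apply: sP; right.
    by rewrite MP//; apply: sP; left.
have /choice[dec decP] lam : exists nu : (set T -> R) * (set T -> R), fin_jordan lam ->
    [/\ fin_additive nu.1, fin_additive nu.2 & forall D, lam D = nu.1 D - nu.2 D].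
  by have [[nu nuP]|n] := pselect (fin_jordan lam); [exists nu | exists (lam, lam)].
exists (fun lam S => fine (M (dec lam).1 S) - fine (M (dec lam).2 S)); split.
- move=> c lam lam' lam'' /decP[a1 a2 aE] /decP[b1 b2 bE] /decP[c1 c2 cE] lE S mS.
  have := rel [:: (c, (dec lam).1); (- c, (dec lam).2); (1, (dec lam').1);
    (-1, (dec lam').2); (-1, (dec lam'').1); (1, (dec lam'').2)].
  move/(_ _ _ S mS); rewrite !big_cons !big_nil/= => h.
  suff : c * fine (M (dec lam).1 S) + (- c * fine (M (dec lam).2 S) +
    (1 * fine (M (dec lam').1 S) + (-1 * fine (M (dec lam').2 S) +
    (-1 * fine (M (dec lam'').1 S) + (1 * fine (M (dec lam'').2 S) + 0))))) = 0.
    by lra.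
  apply: h => [p|D]; first by move=> [<-|[<-|[<-|[<-|[<-|[<-|[]]]]]]].
  rewrite !big_cons big_nil/=; have := lE D; rewrite aE bE cE; lra.
- move=> nu nuP S mS; have [a1 a2 aE] := decP _ (fin_additive_jordan nuP).
  have := rel [:: (1, (dec nu).1); (-1, (dec nu).2); (-1, nu)].
  move/(_ _ _ S mS); rewrite !big_cons !big_nil/= => h.
  suff : 1 * fine (M (dec nu).1 S) + (-1 * fine (M (dec nu).2 S) +
    (-1 * fine (M nu S) + 0)) = 0 by lra.
  apply: h => [p|D]; first by move=> [<-|[<-|[<-|[]]]].
  rewrite !big_cons big_nil/=; have := aE D; lra.
Qed.
End SignedExtension.

(** * Limits of ultrafilters on R^d, and polynomials *)

Lemma measurable_closed {R : realType} {d : nat} (X : set 'rV[R]_d) : closed X ->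
  measurable (X : set (borelR R d)).
Proof.
move=> cX; rewrite -(setCK X); apply: measurableC; apply: sub_sigma_algebra.
exact: closed_openC.
Qed.

Section LimitMap.
Context {R : realType} {d : nat}.
Local Notation T := 'rV[R]_d.

Definition finite_ultra : set (stone T) :=
  \bigcup_n basic [set a : T | `|a| <= n%:R].

Definition ultra_lim (U : stone T) : T := xget 0 [set l : T | ultra_of U --> l].

(** Bounded closed sets of R^d are compact. *)
Lemma ultra_lim_cvg U : finite_ultra U -> ultra_of U --> ultra_lim U.
Proof.
move=> [n _ Un]; have UU := ultra_ofP U.
suff h : exists l : T, ultra_of U --> l.
  exact: (@xgetPex _ (0 : T) [set l : T | ultra_of U --> l] h).
have : compact [set a : T | `|a| <= n%:R].
  apply: bounded_closed_compact.
    exists n%:R; split; first exact: num_real.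
    by move=> M nM a /= an; apply: le_trans an (ltW nM).
  apply: (@closed_comp _ _ (fun a : T => `|a|) [set x | x <= n%:R]); last exact: closed_le.
  by move=> a _; exact: norm_continuous.
by rewrite compact_ultra => /(_ _ UU Un) [l [_ Ul]]; exists l.
Qed.

Lemma ultra_lim_infinite U : ~ finite_ultra U -> ultra_lim U = 0.
Proof.
move=> nU; apply: xgetPN => l Ul; apply: nU.
have UU := ultra_ofP U.
exists (Num.bound (`|l| + 1)) => //=.
have : ultra_of U (ball l 1) by apply: Ul; exact: nbhsx_ballx.
apply: filterS => a; rewrite -ball_normE /= => la.
rewrite (le_trans _ (ltW (archi_boundP _)))// ?addr_ge0//.
by rewrite -(subrK l a) (le_trans (ler_normD _ _))// addrC lerD2l distrC ltW.
Qed.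

Lemma measurable_basic D : measurable (basic D : set (stone_space T)).
Proof. by apply: sub_sigma_algebra; exists D. Qed.

Lemma measurable_finite_ultra : measurable (finite_ultra : set (stone_space T)).
Proof. by apply: bigcupT_measurable => n; exact: measurable_basic. Qed.

(** The limit of U lies in an open set V exactly when, for some n, U contains the
    set of the points whose ball of radius 1 / (n + 1) lies in V. *)
Lemma measurable_ultra_lim :
  measurable_fun setT (ultra_lim : stone_space T -> borelR R d).
Proof.
apply: (@measurability _ _ (stone_space T) (borelR R d) setT ultra_lim (@open T)) => //.
move=> _ [V oV <-]; rewrite setTI.
pose On n := [set a : T | ball a n.+1%:R^-1 `<=` V].
pose B : set (stone_space T) := finite_ultra.
have -> : ultra_lim @^-1` V =
    (B `&` \bigcup_n basic (On n)) `|` (~` B `&` [set _ | V 0]).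
  apply/seteqP; split => U /=.
  - move=> OU; have [BU|nBU] := pselect (B U); last first.
      by right; split => //; rewrite -(ultra_lim_infinite nBU).
    left; split => //; have Ul := ultra_lim_cvg BU; have UU := ultra_ofP U.
    have /nbhs_ballP[_/posnumP[r] rV'] : nbhs (ultra_lim U) V by exact: open_nbhs_nbhs.
    pose n := Num.bound (2 / r%:num).
    have nr : n.+1%:R^-1 + n.+1%:R^-1 <= r%:num.
      have h : 2 / r%:num < n.+1%:R.
        apply: lt_le_trans (archi_boundP _) _; first by rewrite divr_ge0.
        by rewrite ler_nat.
      rewrite (_ : _ + _ = 2 / n.+1%:R); last by ring.
      by rewrite ler_pdivrMr// mulrC -ler_pdivrMr// ltW.
    exists n => //=; have : ultra_of U (ball (ultra_lim U) n.+1%:R^-1).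
      by apply: Ul; apply: nbhsx_ballx; rewrite invr_gt0.
    apply: filterS => a la b ab; apply: rV'; apply: le_ball nr _ _.
    exact: ball_triangle ab.
  - move=> [[BU [n _ Un]]|[nBU O0]]; last by rewrite (ultra_lim_infinite nBU).
    have Ul := ultra_lim_cvg BU; have UU := ultra_ofP U.
    have : ultra_of U (ball (ultra_lim U) n.+1%:R^-1).
      by apply: Ul; apply: nbhsx_ballx; rewrite invr_gt0.
    move=> /(filterI Un) /filter_ex[a [Oa la]]; apply: Oa.
    exact: ball_sym.
have mB : measurable B by exact: measurable_finite_ultra.
apply: measurableU; apply: measurableI => //.
- by apply: bigcupT_measurable => n; exact: measurable_basic.
- exact: measurableC.
- have [V0|nV] := pselect (V 0).
    by rewrite (_ : [set _ | _] = setT)//; apply/seteqP; split.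
  by rewrite (_ : [set _ | _] = set0)//; apply/seteqP; split.
Qed.

Lemma ultra_lim_closed (X : set T) U : closed X -> finite_ultra U -> basic X U ->
  X (ultra_lim U).
Proof.
move=> cX BU XU; have Ul := ultra_lim_cvg BU; have UU := ultra_ofP U.
apply: cX => V /Ul UO; apply: (@filter_ex _ (ultra_of U)).
by apply: filterI.
Qed.

End LimitMap.

Section Poly.
Context {R : realType} {d : nat}.

Definition peval (p : mpoly d R) (a : 'rV[R]_d) : R := meval (fun i => a 0 i) p.

Lemma pevalD p q a : peval (p + q) a = peval p a + peval q a.
Proof. exact: mevalD. Qed.
Lemma pevalB p q a : peval (p - q) a = peval p a - peval q a.
Proof. exact: mevalB. Qed.
Lemma pevalM p q a : peval (p * q) a = peval p a * peval q a.
Proof. exact: mevalM. Qed.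
Lemma peval1 a : peval 1 a = 1.
Proof. exact: meval1. Qed.

Lemma abs_peval_le p a : `|peval p a| <= peval (1 + p * p) a.
Proof.
rewrite pevalD peval1 pevalM.
have := sqr_ge0 (peval p a - 1); have := sqr_ge0 (peval p a + 1).
by rewrite ler_norml; nra.
Qed.

Lemma peval_continuous p : continuous (peval p).
Proof.
rewrite (_ : peval p = fun b : 'rV[R]_d =>
    \sum_(m <- msupp p) mcoeff m p * \prod_i b 0 i ^+ m i); last first.
  by apply/funext => b; rewrite /peval mevalE.
move=> a; apply: (@cvg_big _ _ +%R 0 xpredT (@add_continuous R) _ (nbhs a)) => m _.
apply: cvgMr.
apply: (@cvg_big R 'I_d (@GRing.mul R) 1 xpredT (@mul_continuous R) _ (nbhs a)) => i _.
apply: (@cvg_comp _ _ _ (fun b : 'rV[R]_d => b 0 i) (fun t => t ^+ m i) _ (nbhs (a 0 i))).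
  exact: coord_continuous.
exact: exprn_continuous.
Qed.

Lemma peval_measurable p : measurable_fun setT (peval p : borelR R d -> R).
Proof.
apply: (measurability _ (measurable_realfun.RGenOpens.measurableE R)) => _ [_ [a [b ->] <-]].
rewrite setTI; apply: sub_sigma_algebra.
by have /continuousP := @peval_continuous p; apply; exact: interval_open.
Qed.

Definition norm_poly : mpoly d R := 1 + \sum_i mpolyX R (mnm1 i) ^+ 2.

Lemma norm_polyE a : peval norm_poly a = 1 + \sum_i a 0 i ^+ 2.
Proof.
rewrite pevalD peval1; congr (_ + _); rewrite /peval raddf_sum/=.
by apply: eq_bigr => i _; rewrite rmorphXn/= mevalXU.
Qed.

Lemma norm_le_poly a : `|a| <= peval norm_poly a.
Proof.
rewrite norm_polyE [leLHS]/Num.norm/= mx_normrE; apply/bigmax_leP; split.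
  by rewrite addr_ge0// sumr_ge0// => i _; exact: sqr_ge0.
move=> [i j] _ /=; rewrite ord1 (bigD1 j)//=.
have : 0 <= \sum_(i < d | i != j) a 0 i ^+ 2 by rewrite sumr_ge0// => k _; exact: sqr_ge0.
have := sqr_ge0 (`|a 0 j| - 1); rewrite sqrrB real_normK ?num_real//.
by have := sqr_ge0 (a 0 j); have := normr_ge0 (a 0 j); lra.
Qed.
End Poly.
(** * Integrals of polynomials *)

Lemma archi_eq0 {R : realType} (x C : R) : 0 <= x ->
  (forall n : nat, n%:R * x <= C) -> x = 0.
Proof.
move=> x0 xC; apply/eqP; rewrite eq_le x0 andbT leNgt; apply/negP => x_gt0.
have C0 : 0 <= C by have := xC 0; rewrite mul0r.
have := xC (Num.bound (C / x)); rewrite leNgt => /negP; apply.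
by rewrite -ltr_pdivrMr// archi_boundP// divr_ge0.
Qed.

Section Haviland.
Context {R : realType} {d : nat}.
Local Notation T := 'rV[R]_d.
Variable X : set T.
Hypothesis cX : closed X.

(** A condition on the growth on X alone, so that the product with the indicator
    function of an arbitrary set is again tempered. *)
Definition tempered (f : T -> R) :=
  exists q : mpoly d R, forall a, X a -> `|f a| <= peval q a.

Lemma tempered_peval p : tempered (peval p).
Proof. by exists (1 + p * p) => a _; exact: abs_peval_le. Qed.

Lemma tempered_le f g : tempered g -> (forall a, X a -> `|f a| <= `|g a|) -> tempered f.
Proof. by move=> [q gq] fg; exists q => a Xa; exact: le_trans (fg _ Xa) (gq _ Xa). Qed.

Lemma tempered_lin c f g : tempered f -> tempered g -> tempered (fun a => c * f a + g a).
Proof.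
move=> [q fq] [r gr]; exists (mpolyC d `|c| * q + r) => a Xa.
rewrite pevalD pevalM {1}/peval mevalC; apply: le_trans (ler_normD _ _) _.
by rewrite lerD ?gr// normrM ler_wpM2l// fq.
Qed.

Lemma tempered_ind f D : tempered f -> tempered (fun a => f a * \1_D a).
Proof.
move=> tf; apply: tempered_le tf _ => a _.
by rewrite normrM ler_piMr// indicE normr_nat lern1 leq_b1.
Qed.

Variable J : (T -> R) -> R.
Hypothesis Jlin : forall c f g, tempered f -> tempered g ->
  J (fun a => c * f a + g a) = c * J f + J g.
Hypothesis Jpos : forall f, tempered f -> (forall a, X a -> 0 <= f a) -> 0 <= J f.

Let tempered0 : tempered (fun=> 0).
Proof. by exists 0 => a _; rewrite normr0 /peval meval0. Qed.

Let temperedZ c f : tempered f -> tempered (fun a => c * f a).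
Proof.
move=> tf; have := tempered_lin c tf tempered0.
by rewrite (_ : (fun _ : T => _ * _ + _) = fun a => c * f a)//; apply/funext => a; rewrite addr0.
Qed.

Let J0 : J (fun=> 0) = 0.
Proof.
have := Jlin 1 tempered0 tempered0.
rewrite (_ : (fun _ : T => _ * _ + _) = fun=> 0); first by lra.
by apply/funext => a; rewrite mulr0 addr0.
Qed.

Let JD f g : tempered f -> tempered g -> J (fun a => f a + g a) = J f + J g.
Proof.
move=> tf tg; rewrite -[J f]mul1r -Jlin//; congr J.
by apply/funext => a; rewrite mul1r.
Qed.

Let JZ c f : tempered f -> J (fun a => c * f a) = c * J f.
Proof.
move=> tf; rewrite -[RHS]addr0 -J0 -Jlin//; congr J.
by apply/funext => a; rewrite addr0.
Qed.

Let J_le f g : tempered f -> tempered g -> (forall a, X a -> f a <= g a) -> J f <= J g.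
Proof.
move=> tf tg fg; rewrite -subr_ge0 addrC -mulN1r -Jlin//.
apply: Jpos; first exact: tempered_lin.
by move=> a Xa; have := fg a Xa; lra.
Qed.

Lemma weighted_fin_additive g : tempered g -> (forall a, X a -> 0 <= g a) ->
  fin_additive (fun D => J (fun a => g a * \1_D a)).
Proof.
move=> tg g0; split => [D|A B AB].
  apply: Jpos; first exact: tempered_ind.
  by move=> a Xa; rewrite mulr_ge0 ?g0// indicE.
rewrite -JD; try exact: tempered_ind.
congr J; apply/funext => a; rewrite -mulrDr; congr (_ * _).
rewrite !indicE in_setU.
case: (boolP (a \in A)); case: (boolP (a \in B)) => /=; rewrite ?addr0 ?add0r//.
by move=> /set_mem Ba /set_mem Aa; have : (A `&` B) a by []; rewrite AB.
Qed.

Definition indic_content (D : set T) : R := J \1_D.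

Let nu := indic_content.

Lemma indic_content_additive : fin_additive nu.
Proof.
have t1 : tempered (fun=> 1) by exists 1 => a _; rewrite peval1 normr1.
have := weighted_fin_additive t1 (fun _ _ => ler01).
rewrite (_ : (fun D => _) = nu)//; apply/funext => D; congr J.
by apply/funext => a; rewrite mul1r.
Qed.

Let tempered1 D : tempered (\1_D).
Proof.
by exists 1 => a _; rewrite peval1 indicE normr_nat lern1 leq_b1.
Qed.

Variable M : {measure set (stone_space T) -> \bar R}.
Hypothesis MP : forall D, M (basic D) = (nu D)%:E.

(** Markov's inequality for the finitely additive function [nu]. *)
Let markov p c : (forall a, 0 <= peval p a) -> 0 <= c ->
  c * nu [set a | c <= peval p a] <= J (peval p).
Proof.
move=> p0 c0; rewrite /nu -JZ//; apply: J_le => [||a _].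
- apply: (@tempered_le _ (fun=> c)) => [|a _].
    by exists (mpolyC d `|c|) => a _; rewrite /peval mevalC.
  by rewrite normrM ler_piMr// indicE normr_nat lern1 leq_b1.
- exact: tempered_peval.
- rewrite indicE; case: (boolP (a \in _)) => [/set_mem /=|_]; first by rewrite mulr1.
  by rewrite mulr0.
Qed.

Let Mge0 S : (0 <= M S)%E. Proof. exact: measure_ge0. Qed.

(** The ultrafilters that contain no bounded set lie in every basic set
    {n < |a|}, whose measure is at most J(q) / n for a polynomial q that dominates
    the norm. *)
Lemma finite_ultra_conull : M (~` finite_ultra) = 0%E.
Proof.
have mB : measurable (~` finite_ultra : set (stone_space T)).
  by apply: measurableC; exact: measurable_finite_ultra.
pose C := J (peval norm_poly).
have key n : (n%:R%:E * M (~` finite_ultra) <= C%:E)%E.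
  pose D := [set a : T | n%:R <= peval norm_poly a].
  apply: (@le_trans _ _ (n%:R%:E * M (basic D))%E).
    apply: lee_pmul => //; apply: le_measure; rewrite ?inE//.
      exact: measurable_basic.
    move=> U nU; have : ~ basic [set a : T | `|a| <= n%:R] U by move=> Un; apply: nU; exists n.
    rewrite -[~ _]/((~` basic _) U) -basicC; apply: basic_sub => a /= /negP.
    by rewrite -ltNge => /ltW/le_trans; apply; exact: norm_le_poly.
  rewrite MP -EFinM lee_fin; apply: markov => // a.
  by apply: le_trans (norm_le_poly a).
have fM : M (~` finite_ultra) \is a fin_num.
  rewrite ge0_fin_numE//; apply: (@le_lt_trans _ _ (M setT)); last first.
    by rewrite -basicT MP ltry.
  by apply: le_measure; rewrite ?inE.
rewrite -(fineK fM); congr EFin; apply: (@archi_eq0 _ _ C) => [|n]; first exact: fine_ge0.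
by rewrite -lee_fin EFinM fineK.
Qed.

(** Almost every U contains X, as [J] does not see the complement of X, and then
    its limit lies in the closed set X. *)
Lemma limit_in_conull : M (~` (ultra_lim @^-1` X)) = 0%E.
Proof.
have mB : measurable (~` finite_ultra : set (stone_space T)).
  by apply: measurableC; exact: measurable_finite_ultra.
have mX : measurable (X : set (borelR R d)) by exact: measurable_closed.
have mL : measurable (~` (ultra_lim @^-1` X) : set (stone_space T)).
  by apply: measurableC; rewrite -[X in measurable X]setTI; exact: measurable_ultra_lim.
have nuX : nu (~` X) = 0.
  have nX a : X a -> \1_(~` X) a = 0 :> R.
    by move=> Xa; rewrite indicE memNset//= => /(_ Xa).
  apply/eqP; rewrite eq_le -{1}J0 -{2}J0.
  by apply/andP; split; apply: J_le => // a Xa; rewrite nX.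
apply/eqP; rewrite eq_le Mge0 andbT.
apply: (@le_trans _ _ (M (~` finite_ultra `|` basic (~` X)))%E).
  apply: le_measure; rewrite ?inE//; first by apply: measurableU => //; exact: measurable_basic.
  move=> U nXU; have [BU|] := pselect (finite_ultra U); last by left.
  by right; rewrite basicC => XU; apply: nXU; exact: ultra_lim_closed.
apply: (@le_trans _ _ (M (~` finite_ultra) + M (basic (~` X)))%E).
  by apply: measureU2 => //; exact: measurable_basic.
by rewrite finite_ultra_conull MP nuX add0e.
Qed.

Let conullI (A : set (stone_space T)) : measurable A -> M (A `&` finite_ultra) = M A.
Proof.
move=> mA; have mB := @measurable_finite_ultra R d.
rewrite [RHS](@measureDI _ _ _ M A finite_ultra)//.
rewrite [X in _ = (X + _)%E](_ : _ = 0%E) ?add0e//.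
apply/eqP; rewrite eq_le Mge0 andbT -finite_ultra_conull.
apply: le_measure; [rewrite inE; exact: measurableD | rewrite inE; exact: measurableC |].
by move=> U [].
Qed.

(** For p nonnegative, R^d is cut into the cells on which p lies between k e and
    (k + 1) e.  The integral over the k-th cell and J(p 1_cell) both lie between
    k e nu(cell) and (k + 1) e nu(cell), so the totals differ by at most
    e nu(R^d). *)
Section Cells.
Variables (p : mpoly d R) (e : R).
Hypotheses (p0 : forall a, 0 <= peval p a) (e0 : 0 < e).

Let cell k : set T := [set a | k%:R * e <= peval p a < k.+1%:R * e].

Let cell_triv : trivIset setT cell.
Proof.
move=> i j _ _ [a [/andP[i1 i2] /andP[j1 j2]]]; apply/eqP.
have := le_lt_trans i1 j2; have := le_lt_trans j1 i2.
by rewrite !ltr_pM2r// !ltr_nat !ltnS eqn_leq => -> ->.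
Qed.

Let cell_cover n : [set a | peval p a < n%:R * e] = \bigcup_(k in `I_n) cell k.
Proof.
apply/seteqP; split => a /= => [an|[k /= kn /andP[_ ak]]]; last first.
  by apply: lt_le_trans ak _; rewrite ler_wpM2r ?ler_nat// ltW.
have q0 : 0 <= peval p a / e by rewrite divr_ge0// ltW.
have /andP[h1 h2] := truncn_itv q0.
exists (Num.truncn (peval p a / e)) => /=.
  rewrite -(ltr_nat R); apply: le_lt_trans h1 _.
  by rewrite ltr_pdivrMr.
by apply/andP; split; [rewrite -ler_pdivlMr | rewrite -ltr_pdivrMr].
Qed.

Let f (U : stone_space T) : \bar R := (peval p (ultra_lim U))%:E.

Let f0 U : (0 <= f U)%E. Proof. by rewrite lee_fin. Qed.

Let mf (D : set (stone_space T)) : measurable_fun D f.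
Proof.
apply: (@measurable_funS _ _ _ _ setT) => //.
apply/measurable_EFinP; apply: (@measurableT_comp _ _ _ _ (borelR R d)).
  exact: peval_measurable.
exact: measurable_ultra_lim.
Qed.

Let E k : set (stone_space T) := basic (cell k) `&` finite_ultra.

Let mE k : measurable (E k).
Proof. by apply: measurableI; [exact: measurable_basic | exact: measurable_finite_ultra]. Qed.

Let ME k : M (E k) = (nu (cell k))%:E.
Proof. by rewrite conullI ?MP//; exact: measurable_basic. Qed.

Let f_bounds k U : E k U -> k%:R * e <= peval p (ultra_lim U) <= k.+1%:R * e.
Proof.
move=> [CU BU]; apply/andP; split.
  apply: (@ultra_lim_closed _ _ [set a : T | k%:R * e <= peval p a]) => //.
    apply: (@closed_comp _ _ (peval p) [set x | k%:R * e <= x]); last exact: closed_ge.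
    by move=> a _; exact: peval_continuous.
  by apply: basic_sub CU => a /andP[].
apply: (@ultra_lim_closed _ _ [set a : T | peval p a <= k.+1%:R * e]) => //.
  apply: (@closed_comp _ _ (peval p) [set x | x <= k.+1%:R * e]); last exact: closed_le.
  by move=> a _; exact: peval_continuous.
by apply: basic_sub CU => a /andP[_ /ltW].
Qed.

Let int_cell k : ((k%:R * e * nu (cell k))%:E <= \int[M]_(U in E k) f U <=
  (k.+1%:R * e * nu (cell k))%:E)%E.
Proof.
rewrite !EFinM -ME -!EFinM -!integral_cst//; apply/andP; split.
  apply: ge0_le_integral.
  - exact: mE.
  - by move=> U _; rewrite lee_fin mulr_ge0// ltW.
  - exact: measurable_cst.
  - exact: mf.
  - by move=> U /f_bounds/andP[].
apply: ge0_le_integral.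
- exact: mE.
- by [].
- exact: mf.
- exact: measurable_cst.
- by move=> U /f_bounds/andP[].
Qed.

Let E_cover : \bigcup_k E k = finite_ultra.
Proof.
apply/seteqP; split => U; first by move=> [k _ []].
move=> BU; have Ul := ultra_lim_cvg BU; have UU := ultra_ofP U.
pose n := Num.bound ((peval p (ultra_lim U) + 1) / e).
have ln : peval p (ultra_lim U) < n%:R * e.
  rewrite -ltr_pdivrMr//; apply: lt_trans (archi_boundP _).
    by rewrite ltr_pM2r ?invr_gt0// ltrDl.
  by rewrite divr_ge0 ?addr_ge0// ltW.
have : basic [set a | peval p a < n%:R * e] U.
  apply: Ul; apply: (@open_nbhs_nbhs); split => //.
  apply: (@open_comp _ _ (peval p) [set x | x < n%:R * e]); last exact: open_lt.
  by move=> a _; exact: peval_continuous.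
by rewrite cell_cover basic_bigcup_fin => -[k _ Uk]; exists k.
Qed.

Let E_triv : trivIset setT E.
Proof.
move=> i j _ _ [U [[Ui _] [Uj _]]]; apply: cell_triv => //.
have UU := ultra_ofP U; apply: (@filter_ex _ (ultra_of U)); exact: filterI.
Qed.

Let I := (\int[M]_(U in finite_ultra) f U)%E.

Let I_series : I = (\sum_(0 <= k <oo) \int[M]_(U in E k) f U)%E.
Proof. by rewrite /I -E_cover ge0_integral_bigcup// => U _. Qed.

(** The finitely additive counterpart of the integral of p over D. *)
Let nup D := J (fun a => peval p a * \1_D a).

Let nupP : fin_additive nup.
Proof. by apply: weighted_fin_additive; [exact: tempered_peval | move=> a _]. Qed.

Let nup_bounds k : k%:R * e * nu (cell k) <= nup (cell k) <= k.+1%:R * e * nu (cell k).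
Proof.
have tp : tempered (fun a => peval p a * \1_(cell k) a).
  by apply: tempered_ind; exact: tempered_peval.
have tc c : tempered (fun a => c * \1_(cell k) a).
  by apply: tempered_ind; exists (mpolyC d `|c|) => a _; rewrite /peval mevalC.
rewrite /nu -!JZ//; apply/andP; split; apply: J_le => // a _.
  all: rewrite !indicE; case: (boolP (a \in _)) => [/set_mem/andP[h1 h2]|_].
  all: by rewrite ?mulr1 ?mulr0// ltW.
Qed.

Let sum_nu n : \sum_(0 <= k < n) nu (cell k) <= nu setT.
Proof.
have nuP := indic_content_additive.
by rewrite -fin_additive_sum//; apply: fin_additive_le.
Qed.

Lemma int_upper : (I <= (J (peval p) + e * nu setT)%:E)%E.
Proof.
rewrite I_series; apply: lime_le.
  by apply: is_cvg_nneseries => k _ _; apply: integral_ge0.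
apply: nearW => n.
apply: (@le_trans _ _ (\sum_(0 <= k < n) (nup (cell k) + e * nu (cell k))%:E)%E).
  apply: lee_sum => k _; have /andP[_ h] := int_cell k; apply: le_trans h _.
  have /andP[h _] := nup_bounds k.
  by rewrite lee_fin -natr1 mulrDl mul1r mulrDl lerD2r.
rewrite sumEFin lee_fin big_split/= lerD//; last first.
  by rewrite -mulr_sumr ler_wpM2l// ltW.
rewrite -fin_additive_sum//; apply: (le_trans (fin_additive_le nupP (@subsetT _ _))).
rewrite /nup (_ : (fun a => _) = peval p)//.
by apply/funext => a; rewrite indicT mulr1.
Qed.

Lemma int_lower : ((J (peval p) - e * nu setT)%:E <= I)%E.
Proof.
have I0 : (0 <= I)%E by apply: integral_ge0 => U _.
have fI : I \is a fin_num.
  by rewrite ge0_fin_numE//; apply: le_lt_trans int_upper _; rewrite ltry.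
rewrite -(fineK fI) lee_fin lerBlDr.
have part n : \sum_(0 <= k < n) nup (cell k) <= fine I + e * nu setT.
  apply: (@le_trans _ _ (\sum_(0 <= k < n) (k%:R * e * nu (cell k) + e * nu (cell k)))).
    apply: ler_sum => k _; have /andP[_ h] := nup_bounds k; apply: le_trans h _.
    by rewrite -natr1 mulrDl mul1r mulrDl.
  rewrite big_split/= lerD//; last by rewrite -mulr_sumr ler_wpM2l// ltW.
  rewrite -lee_fin fineK// -sumEFin I_series.
  apply: (@le_trans _ _ (\sum_(0 <= k < n) \int[M]_(U in E k) f U)%E).
    by apply: lee_sum => k _; have /andP[] := int_cell k.
  by apply: nneseries_lim_ge => k _ _; apply: integral_ge0.
(* Beyond the level n e one has p <= p^2 / (n e), so the part of J(p) carried by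
   the cells of index at least n vanishes as n grows. *)
have tail n : n%:R * (e * nup [set a | n%:R * e <= peval p a]) <= J (peval (p * p)).
  rewrite mulrA /nup -JZ; last by apply: tempered_ind; exact: tempered_peval.
  apply: J_le => [||a _].
  - by apply: temperedZ; apply: tempered_ind; exact: tempered_peval.
  - exact: tempered_peval.
  - rewrite pevalM indicE; case: (boolP (a \in _)) => [/set_mem /= h|_].
      by rewrite mulr1 ler_wpM2r.
    by rewrite !mulr0 mulr_ge0.
have split n : J (peval p) = \sum_(0 <= k < n) nup (cell k) + nup [set a | n%:R * e <= peval p a].
  rewrite -fin_additive_sum// -nupP.2.
    rewrite -cell_cover (_ : _ `|` _ = setT).
      by congr J; apply/funext => a; rewrite indicT mulr1.
    by apply/seteqP; split => // a _ /=; case: (ltP (peval p a) (n%:R * e)); [left|right].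
  rewrite -cell_cover; apply/seteqP; split => // a [/= h1 h2].
  by have := lt_le_trans h1 h2; rewrite ltxx.
rewrite leNgt; apply/negP => h.
pose x := J (peval p) - (fine I + e * nu setT).
have x0 : 0 < x by rewrite subr_gt0.
have : x = 0.
  apply: (@archi_eq0 _ _ (J (peval (p * p)) / e)) => [|n]; first exact: ltW.
  rewrite ler_pdivlMr//; apply: le_trans (tail n).
  rewrite -mulrA ler_wpM2l// mulrC ler_wpM2l//; first exact: ltW.
  by rewrite /x (split n) lerBlDr addrC lerD2l.
by move/eqP; rewrite gt_eqF.
Qed.
End Cells.

(** The limit map is defined, and takes its values in X, almost everywhere; the
    previous two bounds for all e > 0 do the rest. *)
Lemma integral_peval p : (forall a, 0 <= peval p a) ->
  (\int[M]_(U in ultra_lim @^-1` X) (peval p (ultra_lim U))%:E = (J (peval p))%:E)%E.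
Proof.
move=> p0.
pose f (U : stone_space T) : \bar R := (peval p (ultra_lim U))%:E.
have mB : measurable (finite_ultra : set (stone_space T)) by exact: measurable_finite_ultra.
have mX : measurable (X : set (borelR R d)) by exact: measurable_closed.
have mL : measurable (ultra_lim @^-1` X : set (stone_space T)).
  by rewrite -[X in measurable X]setTI; exact: measurable_ultra_lim.
have mf : measurable_fun setT f.
  apply/measurable_EFinP; apply: (@measurableT_comp _ _ _ _ (borelR R d)).
    exact: peval_measurable.
  exact: measurable_ultra_lim.
have f0 U : (0 <= f U)%E by rewrite lee_fin.
have -> : (\int[M]_(U in ultra_lim @^-1` X) f U = \int[M]_(U in finite_ultra) f U)%E.
  transitivity (\int[M]_(U in setT) f U)%E.
    rewrite [RHS](@ge0_negligible_integral _ _ _ M setT (~` (ultra_lim @^-1` X)))//.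
    - by rewrite setTD setCK.
    - exact: measurableC.
    - exact: limit_in_conull.
  rewrite [LHS](@ge0_negligible_integral _ _ _ M setT (~` finite_ultra))//.
  - by rewrite setTD setCK.
  - exact: measurableC.
  - exact: finite_ultra_conull.
have nu0 : 0 <= nu setT by apply: (indic_content_additive).1.
have c0 : 0 < 1 + nu setT by rewrite ltr_wpDr.
apply/eqP; rewrite eq_le; apply/andP; split; apply/lee_addgt0Pr => e e0.
  have e1 : 0 < e / (1 + nu setT) by rewrite divr_gt0.
  apply: le_trans (int_upper p0 e1) _; rewrite -EFinD lee_fin lerD2l.
  by rewrite mulrAC ler_pdivrMr// ler_wpM2l ?ltW// ltrDr.
have e1 : 0 < e / (1 + nu setT) by rewrite divr_gt0.
rewrite -leeBlDr//; apply: le_trans (int_lower p0 e1).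
rewrite -EFinB lee_fin lerD2l lerN2.
by rewrite mulrAC ler_pdivrMr// ler_wpM2l ?ltW// ltrDr.
Qed.

End Haviland.
(** * Extension of the scalar functional *)

Section Tens.
Context {R : realType} (d : nat) (V : lmodType R).
Implicit Types (p q : mpoly d R) (A B : V).

Lemma tensBr p A B : tens p (A - B) = tens p A - tens p B.
Proof. by apply/val_inj/funext => k; rewrite /= scalerBr. Qed.

Lemma tensBl p q A : tens (p - q) A = tens p A - tens q A.
Proof. by apply/val_inj/funext => k; rewrite /= mcoeffB scalerBl. Qed.
End Tens.

(** An integral depends on the values of the measure at measurable sets only;
    this lets a bare set function g stand for the measure m1. *)
Section MeasureAgree.
Context {R : realType} d (T : measurableType d).
Variables (m1 : {measure set T -> \bar R}) (g : set T -> \bar R).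
Hypothesis g0 : forall D, (0 <= g D)%E.
Hypothesis gm : forall D, measurable D -> g D = m1 D.

Let g_set0 : g set0 = 0%E. Proof. by rewrite gm. Qed.

Let g_sigma : semi_sigma_additive g.
Proof.
move=> F mF tF mU; rewrite gm//.
under eq_fun do under eq_bigr do rewrite gm//.
exact: measure_semi_sigma_additive.
Qed.

HB.instance Definition _ := isMeasure.Build d T R g g_set0 g0 g_sigma.

Lemma integral_agree D f : (\int[g]_(a in D) f a = \int[m1]_(a in D) f a)%E.
Proof. by apply: eq_measure_integral => A mA _; exact: gm. Qed.
End MeasureAgree.

Section PolyIntegral.
Context {R : realType} {d : nat} (X : set 'rV[R]_d).
Variables (mu : {measure set (borelR R d) -> \bar R}) (l : mpoly d R -> R).
Hypothesis mX : measurable (X : set (borelR R d)).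
Hypothesis lB : forall p q, l (p - q) = l p - l q.
Hypothesis mul : forall p, (forall a, 0 <= peval p a) ->
  (\int[mu]_(a in X) (peval p a)%:E = (l p)%:E)%E.

Let mp p : measurable_fun (X : set (borelR R d)) (EFin \o (peval p : borelR R d -> R)).
Proof.
apply/measurable_EFinP; apply: (@measurable_funS _ _ _ _ setT) => //.
exact: peval_measurable.
Qed.

Let sq_ge0 (p : mpoly d R) a : 0 <= peval (1 + p * p) a.
Proof. exact: le_trans (normr_ge0 _) (abs_peval_le p a). Qed.

Lemma integral_abs_peval p : (\int[mu]_(a in X) `|peval p a|%:E <= (l (1 + p * p)%R)%:E)%E.
Proof.
rewrite -mul//; apply: ge0_le_integral => //.
- have mpp : measurable_fun (X : set (borelR R d)) (peval p : borelR R d -> R).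
    by apply/measurable_EFinP; exact: mp.
  by apply/measurable_EFinP; exact: (measurableT_comp (@normr_measurable R setT) mpp).
- exact: mp.
- by move=> a _; rewrite lee_fin abs_peval_le.
Qed.

Lemma integrable_peval p :
  mu.-integrable (X : set (borelR R d)) (EFin \o (peval p : borelR R d -> R)).
Proof.
apply/integrableP; split; first exact: mp.
by apply: le_lt_trans (integral_abs_peval p) _; rewrite ltry.
Qed.

(** p = (1 + p^2) - (1 + p^2 - p) is a difference of nonnegative polynomials, to
    which the hypothesis applies. *)
Lemma integral_signed_peval p : (\int[mu]_(a in X) (peval p a)%:E = (l p)%:E)%E.
Proof.
pose q : mpoly d R := 1 + p * p; pose r := q - p.
have -> : p = q - r by rewrite subKr.
have e a : (peval (q - r) a)%:E = ((EFin \o peval q) a - (EFin \o peval r) a)%E.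
  by rewrite pevalB EFinB.
under eq_integral do rewrite e.
rewrite integralB//; try exact: integrable_peval.
have q0 a : 0 <= peval q a by exact: sq_ge0.
have r0 a : 0 <= peval r a.
  rewrite pevalB subr_ge0; apply: le_trans (abs_peval_le p a).
  exact: ler_norm.
by rewrite (mul q0) (mul r0) [in RHS]lB EFinB.
Qed.
End PolyIntegral.

Section Main.
Context {R : realType} {H K : hilbertType R} {d : nat}.
Variable X : set 'rV[R]_d.
Variable L : {linear vpoly d (Bh H) -> Bh K}.
Hypothesis cX : closed X.
Hypothesis CP : forall (n : nat) (G : 'M[vpoly d (Bh H)]_n),
    (forall j l, G j l = G l j) ->
    (forall a : 'rV[R]_d, X a ->
      block_psd (\matrix_(j, l) veval (fun i => a 0 i) (G j l))) ->
    block_psd (\matrix_(j, l) L (G j l)).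

Local Notation Y := ('rV[R]_d * {linear K -> H})%type.
Local Notation hom := {linear K -> H}.

Let pos : set (Y -> R) := [set g | forall y, X y.1 -> 0 <= g y].

Let W0 : set ((Y -> R) * R) := [set (quad s, quadL L s) | s in setT].

Lemma quad_cat s t y : @quad R H K d (s ++ t) y = quad s y + quad t y.
Proof. by rewrite /quad big_cat. Qed.

Lemma quad_scale c s y :
  @quad R H K d [seq (c *: Fx.1, Fx.2) | Fx <- s] y = c * quad s y.
Proof.
rewrite /quad big_map mulr_sumr; apply: eq_bigr => Fx _ /=.
by rewrite linearZ/= -innerZl.
Qed.

Lemma quadL_cat s t : quadL L (s ++ t) = quadL L s + quadL L t.
Proof. by rewrite /quadL big_cat. Qed.

Lemma quadL_scale c s : quadL L [seq (c *: Fx.1, Fx.2) | Fx <- s] = c * quadL L s.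
Proof.
rewrite /quadL big_map mulr_sumr; apply: eq_bigr => Fx _ /=.
by rewrite linearZ/= -innerZl.
Qed.

Let W0_linrel : pos_linrel pos W0.
Proof.
split.
- exists [::] => //; congr (_, _); last by rewrite /quadL big_nil.
  by apply/funext => y; rewrite /quad big_nil.
- move=> c _ _ _ _ [s _ [<- <-]] [t _ [<- <-]].
  exists ([seq (c *: Fx.1, Fx.2) | Fx <- s] ++ t) => //; congr (_, _).
    by apply/funext => y; rewrite quad_cat quad_scale.
  by rewrite quadL_cat quadL_scale.
- by move=> _ _ [s _ [<- <-]] s0; exact: quadL_ge0 CP _ s0.
Qed.

Let dominated_by := @dominated R (Y -> R) pos W0.

(** The functions of T that squares dominate.  As c times |T x|^2 is the
    function attached to c Id (x) x (x) x, products of tempered functions and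
    bounded forms are dominated by the functions [quad s]. *)
Definition form_bounded (h : hom -> R) := exists c (s : seq K), 0 <= c /\
  forall T, `|h T| <= c * \sum_(x <- s) `|(T : hom) x| ^+ 2.

Lemma form_bounded_lin c h h' : form_bounded h -> form_bounded h' ->
  form_bounded (fun T => c * h T + h' T).
Proof.
move=> [a [s [a0 hs]]] [b [t [b0 ht]]]; exists (`|c| * a + b), (s ++ t).
split; first by rewrite addr_ge0// mulr_ge0.
move=> T; rewrite big_cat/=; apply: le_trans (ler_normD _ _) _.
have s0 : 0 <= \sum_(x <- s) `|T x| ^+ 2 by apply: sumr_ge0 => x _; exact: sqr_ge0.
have t0 : 0 <= \sum_(x <- t) `|T x| ^+ 2 by apply: sumr_ge0 => x _; exact: sqr_ge0.
rewrite mulrDl lerD//.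
  rewrite normrM -mulrA ler_wpM2l//; apply: le_trans (hs T) _.
  by rewrite ler_wpM2l// lerDl.
by apply: le_trans (ht T) _; rewrite ler_wpM2l// lerDr.
Qed.

Lemma quad_tens (p : mpoly d R) (A : Bh H) x y :
  quad [:: (tens p A, x)] y = peval p y.1 * inner (A (y.2 x)) ((y.2 : hom) x).
Proof. by rewrite /quad big_seq1/= veval_tens -innerZl. Qed.

Lemma quadL_tens p A x : quadL L [:: (tens p A, x)] = inner (L (tens p A) x) x.
Proof. by rewrite /quadL big_seq1. Qed.

Let form_dominated f h : tempered X f -> form_bounded h ->
  dominated_by (fun y => f y.1 * h y.2).
Proof.
move=> [q fq] [c [s [c0 hs]]].
pose w := quad [seq (tens q (c *: Bh_id), x) | x <- s] : Y -> R.
have wE y : w y = peval q y.1 * (c * \sum_(x <- s) `|(y.2 : hom) x| ^+ 2).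
  rewrite /w /quad big_map !mulr_sumr; apply: eq_bigr => x _ /=.
  rewrite veval_tens -innerxx -!innerZl; congr (inner _ _).
have le y : X y.1 -> `|f y.1 * h y.2| <= w y.
  by move=> Xy; rewrite wE normrM ler_pM// ?fq.
have W0w : W0 (w, quadL L [seq (tens q (c *: Bh_id), x) | x <- s]) by eexists.
split; exists w, (quadL L [seq (tens q (c *: Bh_id), x) | x <- s]); split=> // y Xy.
  change (0 <= w y - f y.1 * h y.2); rewrite subr_ge0.
  by apply: le_trans (le y Xy); exact: ler_norm.
change (0 <= w y + f y.1 * h y.2); rewrite addrC -(opprK (w y)) subr_ge0.
by have := le y Xy; rewrite ler_norml => /andP[].
Qed.

(** [Phi f h] is the value of the extended functional at the product of f, a
    function of the point, and h, a function of the linear map. *)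
Lemma functional_extension : exists Phi : ('rV[R]_d -> R) -> (hom -> R) -> R,
  [/\ forall c f g h, tempered X f -> tempered X g -> form_bounded h ->
        Phi (fun a => c * f a + g a) h = c * Phi f h + Phi g h,
      forall c f h h', tempered X f -> form_bounded h -> form_bounded h' ->
        Phi f (fun T => c * h T + h' T) = c * Phi f h + Phi f h',
      forall f h, tempered X f -> form_bounded h ->
        (forall a T, X a -> 0 <= f a * h T) -> 0 <= Phi f h
    & forall p (A : Bh H) x, Phi (peval p) (fun T => inner (A (T x)) (T x)) =
        inner (L (tens p A) x) x].
Proof.
have h0 : pos 0 by move=> y _.
have hD u v : pos u -> pos v -> pos (u + v).
  by move=> u0 v0 y Xy; rewrite addr_ge0 ?u0 ?v0.
have hZ c u : 0 < c -> pos u -> pos (c *: u).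
  by move=> c0 u0 y Xy; rewrite mulr_ge0 ?u0// ltW.
have [phi [phiW philin phipos]] := riesz_extension h0 hD hZ W0_linrel.
exists (fun f h => phi (fun y => f y.1 * h y.2)); split.
- move=> c f g h tf tg hh; rewrite -philin; try exact: form_dominated.
  by congr phi; apply/funext => y; rewrite -[RHS]/(c * (f y.1 * h y.2) + g y.1 * h y.2); ring.
- move=> c f h h' tf hh hh'; rewrite -philin; try exact: form_dominated.
  by congr phi; apply/funext => y; rewrite -[RHS]/(c * (f y.1 * h y.2) + f y.1 * h' y.2); ring.
- by move=> f h tf hh fh; apply: phipos; [exact: form_dominated | move=> y /fh].
- move=> p A x; rewrite -quadL_tens; apply: phiW; eexists; first by [].
  by congr (_, _); apply/funext => y; rewrite quad_tens.
Qed.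
End Main.
(** * The operator-valued measure *)

Section Forms.
Context {R : realType} {H K : hilbertType R} {d : nat}.
Local Notation hom := {linear K -> H}.
Variable X : set 'rV[R]_d.
Variable Phi : ('rV[R]_d -> R) -> (hom -> R) -> R.
Hypothesis Phi_linl : forall c f g h, tempered X f -> tempered X g -> form_bounded h ->
  Phi (fun a => c * f a + g a) h = c * Phi f h + Phi g h.
Hypothesis Phi_linr : forall c f h h', tempered X f -> form_bounded h -> form_bounded h' ->
  Phi f (fun T => c * h T + h' T) = c * Phi f h + Phi f h'.
Hypothesis Phi_pos : forall f h, tempered X f -> form_bounded h ->
  (forall a T, X a -> 0 <= f a * h T) -> 0 <= Phi f h.

Definition form (A : Bh H) (x y : K) (T : hom) : R := inner (A (T x)) (T y).

Lemma form_bounded_form A x y : form_bounded (form A x y).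
Proof.
exists `|A|, [:: x; y]; split => // T.
by rewrite !big_cons big_nil addr0; exact: inner_Bh_le.
Qed.

Lemma form_bounded_sum c (s : seq K) : 0 <= c ->
  form_bounded (fun T : hom => c * \sum_(x <- s) `|T x| ^+ 2).
Proof.
move=> c0; exists c, s; split => // T; rewrite ger0_norm// mulr_ge0//.
by apply: sumr_ge0 => x _; exact: sqr_ge0.
Qed.

Let lam h D := Phi \1_D h.

Let tempered1 D : tempered X \1_D.
Proof. by exists 1 => a _; rewrite peval1 indicE normr_nat lern1 leq_b1. Qed.

Let lam_additive h : form_bounded h -> (forall T, 0 <= h T) -> fin_additive (lam h).
Proof.
move=> hb h0; apply: (@indic_content_additive _ _ X (Phi^~ h)) => [c f g tf tg|f tf f0].
  exact: Phi_linl.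
by apply: Phi_pos => // a T Xa; rewrite mulr_ge0 ?f0.
Qed.

Let lam_jordan h : form_bounded h -> fin_jordan (lam h).
Proof.
move=> hb; have [c [s [c0 hs]]] := hb.
pose w (T : hom) := c * \sum_(x <- s) `|T x| ^+ 2.
have wb : form_bounded w by exact: form_bounded_sum.
have w0 T : 0 <= w T by exact: le_trans (hs T).
have hwb : form_bounded (fun T => -1 * h T + w T) by exact: form_bounded_lin.
exists (lam w, lam (fun T => -1 * h T + w T)); split => [||D] /=.
- exact: lam_additive.
- apply: lam_additive => // T.
  by rewrite mulN1r addrC subr_ge0 (le_trans (ler_norm _) (hs T)).
- by rewrite /lam Phi_linr//; ring.
Qed.

(** For h bounded, D |-> Phi 1_D h is a difference of finitely additive functions:
    if w is a sum of squares that dominates h, those of w and of w - h. *)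
Lemma form_extension : exists b : set (stone_space 'rV[R]_d) -> (hom -> R) -> R,
  (forall S c h h', measurable S -> form_bounded h -> form_bounded h' ->
    b S (fun T => c * h T + h' T) = c * b S h + b S h') /\
  (forall h, form_bounded h -> (forall T, 0 <= h T) ->
    exists M : {measure set (stone_space 'rV[R]_d) -> \bar R},
      (forall D, M (basic D) = (Phi \1_D h)%:E) /\
      forall S, measurable S -> M S = (b S h)%:E).
Proof.
have [M [Mfin MP]] := @stone_measures R 'rV[R]_d.
have [ext [ext_lin ext_pos]] := signed_extension Mfin MP.
exists (fun S h => ext (lam h) S); split.
  move=> S c h h' mS hb hb'; apply: ext_lin => //; try exact: lam_jordan.
    by apply: lam_jordan; exact: form_bounded_lin.
  by move=> D; rewrite /lam Phi_linr.
move=> h hb h0; have la := lam_additive hb h0.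
exists (M (lam h)); split => [D|S mS]; first exact: MP.
rewrite ext_pos// fineK// ge0_fin_numE//; apply: le_lt_trans (Mfin (lam h)).
by apply: le_measure; rewrite ?inE.
Qed.

End Forms.

Section Operators.
Context {R : realType} {H K : hilbertType R} {d : nat}.
Local Notation hom := {linear K -> H}.
Variables (b : (hom -> R) -> R) (C : R).
Hypothesis b_lin : forall c h h', form_bounded h -> form_bounded h' ->
  b (fun T => c * h T + h' T) = c * b h + b h'.
Hypothesis b_pos : forall h, form_bounded h -> (forall T, 0 <= h T) -> 0 <= b h.
Hypothesis b_le : forall x, b (form Bh_id x x) <= C * `|x| ^+ 2.
Hypothesis C0 : 0 <= C.

(** Both w + form and w - form are nonnegative for w = |A| (|T x|^2 + |T y|^2). *)
Let b_abs A x y : `|b (form A x y)| <= `|A| * C * (`|x| ^+ 2 + `|y| ^+ 2).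
Proof.
pose f := form (H := H) Bh_id x x; pose g := form (H := H) Bh_id y y.
have fb : form_bounded f by exact: form_bounded_form.
have gb : form_bounded g by exact: form_bounded_form.
have hb : form_bounded (form A x y) by exact: form_bounded_form.
pose w T := `|A| * f T + ((`|A| - 1) * g T + g T).
have wb : form_bounded w.
  exact: form_bounded_lin fb (form_bounded_lin (`|A| - 1) gb gb).
have bw : b w <= `|A| * C * (`|x| ^+ 2 + `|y| ^+ 2).
  rewrite /w !b_lin//; last exact: form_bounded_lin.
  have := ler_wpM2l (normr_ge0 A) (b_le x); have := ler_wpM2l (normr_ge0 A) (b_le y).
  by rewrite -/f -/g; lra.
have hw T : `|form A x y T| <= w T.
  apply: le_trans (inner_Bh_le _ _ _) _; rewrite /w /f /g /form /= !innerxx.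
  by rewrite le_eqVlt; apply/orP; left; apply/eqP; ring.
have h1 : 0 <= b (fun T => -1 * form A x y T + w T).
  apply: b_pos; first exact: form_bounded_lin.
  by move=> T; have := hw T; rewrite ler_norml => /andP[]; lra.
have h2 : 0 <= b (fun T => 1 * form A x y T + w T).
  apply: b_pos; first exact: form_bounded_lin.
  by move=> T; have := hw T; rewrite ler_norml => /andP[]; lra.
rewrite b_lin// in h1; rewrite b_lin// in h2.
by rewrite ler_norml; apply/andP; split; lra.
Qed.

Lemma form_blinear : exists m : blinear (Bh H) (Bh K),
  forall A x y, inner (m A x) y = b (form A x y).
Proof.
have /choice[g gP] (A : Bh H) : exists B : Bh K,
    (forall x y, inner (B x) y = b (form A x y)) /\ `|B| <= 2 * (`|A| * C).
  have [||||B BE Bn] := @form_operator R K (fun x y => b (form A x y)) (`|A| * C).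
  - by rewrite mulr_ge0.
  - move=> c x y z; rewrite -b_lin; try exact: form_bounded_form.
    by congr b; apply/funext => T; rewrite /form !linearP innerDZl.
  - by move=> x y; congr b; apply/funext => T; rewrite /form Bh_sym innerC.
  - exact: b_abs.
  - by exists B.
have glin : linear g.
  move=> c A B; apply: Bh_eq => x; rewrite (gP _).1 BhDE BhZE innerDZl !(gP _).1 -b_lin;
    try exact: form_bounded_form.
  by congr b; apply/funext => T; rewrite /form BhDE BhZE innerDZl.
pose G : {linear Bh H -> Bh K} :=
  HB.pack g (GRing.isLinear.Build R (Bh H) (Bh K) *:%R g glin).
have Gb : exists k : R, forall A, `|G A| <= k * `|A|.
  exists (2 * C) => A; apply: le_trans (gP A).2 _.
  by rewrite mulrA mulrAC.
by exists (MkBlinear Gb) => A x y; exact: (gP A).1.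
Qed.
End Operators.

Section Final.
Context {R : realType} {H K : hilbertType R} {d : nat}.
Local Notation hom := {linear K -> H}.
Variable X : set 'rV[R]_d.
Variable L : {linear vpoly d (Bh H) -> Bh K}.
Hypothesis cX : closed X.
Hypothesis CP : forall (n : nat) (G : 'M[vpoly d (Bh H)]_n),
    (forall j l, G j l = G l j) ->
    (forall a : 'rV[R]_d, X a ->
      block_psd (\matrix_(j, l) veval (fun i => a 0 i) (G j l))) ->
    block_psd (\matrix_(j, l) L (G j l)).

(** The operator m(D)(A) has the form (x, y) |-> b (ultra_lim^-1 D) <A T x, T y>;
    for A positive, its diagonal value at x is the image under the limit map of
    a measure on ultrafilters, whose polynomial integrals are known.  Its total
    mass at A = Id is <L(1 (x) Id) x, x>, which bounds the form. *)
Lemma scalar_measures : exists m : set (borelR R d) -> blinear (Bh H) (Bh K),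
  (forall D A, ~ measurable D -> m D A = 0) /\
  (forall A x, psd A -> exists mu : {measure set (borelR R d) -> \bar R},
    (forall D, measurable D -> mu D = (inner (m D A x) x)%:E) /\
    (forall p, (forall a, 0 <= peval p a) ->
      (\int[mu]_(a in X) (peval p a)%:E = (inner (L (tens p A) x) x)%:E)%E)).
Proof.
have [Phi [Phil Phir Phip PhiE]] := @functional_extension R H K d X L CP.
have [b [b_lin b_meas]] := form_extension Phil Phir Phip.
have e1 : \1_[set: 'rV[R]_d] = peval 1 :> ('rV[R]_d -> R).
  by apply/funext => a; rewrite indicT peval1.
have mU : measurable_fun setT (ultra_lim : stone_space 'rV[R]_d -> borelR R d).
  exact: measurable_ultra_lim.
have mpre (D : set (borelR R d)) : measurable D ->
    measurable (ultra_lim @^-1` D : set (stone_space 'rV[R]_d)).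
  by move=> mD; rewrite -[X in measurable X]setTI; exact: mU.
have /choice[m mP] (D : set (borelR R d)) : exists mD : blinear (Bh H) (Bh K),
    (~ measurable D -> forall A, mD A = 0) /\
    (measurable D -> forall A x y, inner (mD A x) y = b (ultra_lim @^-1` D) (form A x y)).
  have [mD|nD] := pselect (measurable D); last first.
    have z : exists k : R, forall A : Bh H, `|(\0 : {linear Bh H -> Bh K}) A| <= k * `|A|.
      by exists 0 => A; rewrite mul0r normr0.
    by exists (MkBlinear z).
  have [||||m mE] := @form_blinear R H K (b (ultra_lim @^-1` D)) `|L (tens 1 Bh_id)|.
  - by move=> c h h'; apply: b_lin; exact: mpre.
  - move=> h hb h0; have [M [_ ME]] := b_meas h hb h0.
    by rewrite -lee_fin -ME ?measure_ge0//; exact: mpre.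
  - move=> x; have hb := form_bounded_form (H := H) Bh_id x x.
    have h0 (T : hom) : 0 <= form Bh_id x x T by rewrite /form /= innerxx sqr_ge0.
    have [M [MB ME]] := b_meas _ hb h0.
    apply: (@le_trans _ _ (Phi \1_setT (form Bh_id x x))).
      rewrite -lee_fin -MB -ME; last exact: mpre.
      by apply: le_measure; rewrite ?inE ?basicT//; exact: mpre.
    rewrite e1 PhiE; apply: le_trans (ler_norm _) _.
    apply: le_trans (cauchy_schwarz _ _) _; rewrite expr2 mulrA.
    by rewrite ler_wpM2r// opnorm_le.
  - by [].
  - by exists m.
exists m; split=> [D A nD|A x Ap]; first by have [-> //] := mP D.
have hb := form_bounded_form A x x.
have h0 T : 0 <= form A x x T by exact: Ap.
have [M [MB ME]] := b_meas _ hb h0.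
have mX : measurable (X : set (borelR R d)) by exact: measurable_closed.
have [mu [muE muI]] : exists mu : {measure set (borelR R d) -> \bar R},
    (forall D, mu D = M (ultra_lim @^-1` D)) /\
    (forall p, (forall a, 0 <= peval p a) -> (\int[mu]_(a in X) (peval p a)%:E =
      \int[M]_(U in ultra_lim @^-1` X) (peval p (ultra_lim U))%:E)%E).
  unshelve eexists (pushforward M (ultra_lim : stone_space 'rV[R]_d -> borelR R d)).
    exact: mU.
  split => // p p0; apply: (ge0_integral_pushforward mU M mX).
    apply/measurable_EFinP; apply: (@measurable_funS _ _ _ _ setT) => //.
    exact: peval_measurable.
  by move=> a _; rewrite lee_fin.
exists mu; split=> [D mD|p p0].
  by rewrite muE ME ?(mP D).2//; exact: mpre.
rewrite muI// -PhiE.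
apply: (@integral_peval _ _ X cX (Phi^~ (form A x x))) => // [c f g tf tg|f tf f0].
  exact: Phil.
by apply: Phip => // a T Xa; rewrite mulr_ge0 ?f0.
Qed.
End Final.
Section Povm.
Context {R : realType} {K : hilbertType R} {d : nat}.
Variable X : set 'rV[R]_d.
Hypothesis cX : closed X.
Variable E : set (borelR R d) -> Bh K.
Hypothesis E0 : forall D, ~ measurable D -> E D = 0.
Hypothesis E_measure : forall x, exists mu : {measure set (borelR R d) -> \bar R},
  forall D, measurable D -> mu D = (inner (E D x) x)%:E.

(** The order on operators is that of their quadratic forms, so the supremum
    clause is continuity from below of each scalar measure. *)
Lemma povm_of_measures : povm (borel X) E.
Proof.
have psdE D : measurable D -> psd (E D).
  move=> mD x; have [mu muE] := E_measure x.
  by rewrite -lee_fin -muE.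
split.
- by move=> D; rewrite borel_closedE// => -[mD _]; exact: psdE.
- move=> A B; rewrite borel_closedE// => -[mA _] [mB _] AB; apply: Bh_eq => x.
  have [mu muE] := E_measure x.
  apply/EFin_inj; rewrite BhDE innerDl EFinD -!muE//; last exact: measurableU.
  exact: measureU.
- move=> F; rewrite borel_closedE// => bF nF [mU _].
  have mF i : measurable (F i : set (borelR R d)) by have [] := bF i.
  split => [i x|B BF x].
    have [mu muE] := E_measure x.
    rewrite BhBE innerBl subr_ge0 -lee_fin -!muE//.
    by apply: le_measure; rewrite ?inE//; exact: bigcup_sup.
  have [mu muE] := E_measure x.
  rewrite BhBE innerBl subr_ge0 -lee_fin -muE//.
  have cv : mu (F n) @[n --> \oo] --> mu (\bigcup_n F n).
    by apply: nondecreasing_cvg_mu => //; apply/nondecreasing_seqP => n; apply/subsetPset.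
  rewrite -(cvg_lim _ cv)//; apply: lime_le; first by apply/cvg_ex; eexists; exact: cv.
  apply: nearW => n; rewrite muE// lee_fin -subr_ge0 -innerBl.
  exact: BF.
Qed.

(** Outside the Borel sets E vanishes, which keeps [povm_form] nonnegative on all
    sets, as a measure has to be. *)
Lemma povm_form_integral x (mu : {measure set (borelR R d) -> \bar R}) f :
  (forall D, measurable D -> mu D = (inner (E D x) x)%:E) ->
  (\int[povm_form E X x]_(a in X) f a = \int[mu]_(a in X) f a)%E.
Proof.
move=> muE.
have mX : measurable (X : set (borelR R d)) by exact: measurable_closed.
have h0 D : (0 <= povm_form E X x D)%E.
  rewrite /povm_form; have [mD|nD] := pselect (measurable (D `&` X)).
    by rewrite -muE.
  by rewrite E0// Bh0E inner0l.
have hm D : measurable D -> povm_form E X x D = mrestr mu mX D.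
  by move=> mD; rewrite /povm_form /mrestr muE//; exact: measurableI.
rewrite (integral_agree h0 hm); apply: eq_measure_integral => A mA AX.
by rewrite /= /mrestr setIidl.
Qed.

Variable l : mpoly d R -> Bh K.
Hypothesis lB : forall p q, l (p - q) = l p - l q.
Hypothesis E_int : forall x, exists mu : {measure set (borelR R d) -> \bar R},
  (forall D, measurable D -> mu D = (inner (E D x) x)%:E) /\
  (forall p, (forall a, 0 <= peval p a) ->
      (\int[mu]_(a in X) (peval p a)%:E = (inner (l p x) x)%:E)%E).

Let mX : measurable (X : set (borelR R d)).
Proof. exact: measurable_closed. Qed.

Let lxB x p q : inner (l (p - q) x) x = inner (l p x) x - inner (l q x) x.
Proof. by rewrite lB BhBE innerBl. Qed.

Lemma povm_integrable_peval p : povm_integrable E X (peval p).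
Proof.
split; first by apply: (@measurable_funS _ _ _ _ setT) => //; exact: peval_measurable.
exists `|l (1 + p * p)| => x; have [mu [muE muI]] := E_int x.
rewrite (povm_form_integral _ muE).
apply: (le_trans (integral_abs_peval mX muI p)).
rewrite lee_fin; apply: le_trans (ler_norm _) _.
apply: le_trans (cauchy_schwarz _ _) _; rewrite expr2 mulrA.
by rewrite ler_wpM2r// opnorm_le.
Qed.

Lemma povm_integral_peval p : povm_integral E X (peval p) = l p.
Proof.
rewrite /povm_integral.
have lP : [set S : Bh K | forall x, (inner (S x) x)%:E =
    (\int[povm_form E X x]_(a in X) (peval p a)%:E)%E] (l p).
  move=> x /=; have [mu [muE muI]] := E_int x.
  rewrite (povm_form_integral _ muE).
  by rewrite (integral_signed_peval mX (l := fun p => inner (l p x) x) (lxB x) muI).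
have := xgetPex 0 (ex_intro _ _ lP) => /= h.
by apply: Bh_eq => x; apply/EFin_inj; rewrite h -lP.
Qed.

End Povm.

Theorem theorem4 (R : realType) (H K : hilbertType R) (d : nat)
    (X : set 'rV[R]_d) (L : {linear vpoly d (Bh H) -> Bh K}) :
  closed X ->
  (forall (n : nat) (G : 'M[vpoly d (Bh H)]_n),
    (forall j l, G j l = G l j) ->
    (forall a : 'rV[R]_d, X a ->
      block_psd (\matrix_(j, l) veval (fun i => a 0 i) (G j l))) ->
    block_psd (\matrix_(j, l) L (G j l))) ->
  exists m : set (borelR R d) -> blinear (Bh H) (Bh K),
    [/\ novm (borel X) m,
        forall p : mpoly d R,
          novm_integrable m X (fun a : 'rV[R]_d => meval (fun i => a 0 i) p)
      & forall (F : vpoly d (Bh H)) (s : seq (mpoly d R * Bh H)),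
          F = \sum_(pA <- s) tens pA.1 pA.2 ->
          L F = \sum_(pA <- s)
            novm_integral m X (fun a : 'rV[R]_d => meval (fun i => a 0 i) pA.1)
              pA.2].
Proof.
move=> cX CP; have [m [m0 mP]] := scalar_measures cX CP.
have mE A D : ~ measurable D -> m D A = 0 by move=> nD; exact: m0.
have mM A : psd A -> forall x, exists mu : {measure set (borelR R d) -> \bar R},
    forall D, measurable D -> mu D = (inner (m D A x) x)%:E.
  by move=> Ap x; have [mu [muE _]] := mP A x Ap; exists mu.
have lB A p q : L (tens (p - q) A) = L (tens p A) - L (tens q A).
  by rewrite tensBl linearB.
have int A p : psd A -> povm_integral (fun D => m D A) X (peval p) = L (tens p A).
  move=> Ap; apply: (povm_integral_peval cX (mE A) (l := fun p => L (tens p A))) => [q r|x].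
    exact: lB.
  exact: mP.
exists m; split.
- by move=> A Ap; apply: povm_of_measures (mM A Ap).
- move=> p A Ap.
  apply: (povm_integrable_peval cX (mE A) (l := fun p => L (tens p A))) => x.
  exact: mP.
- move=> F s ->; rewrite linear_sum; apply: eq_bigr => -[p A] _ /=.
  have [Pp Np AE _ _] := posnegP A.
  by rewrite /novm_integral !int// -linearB -tensBr -AE.
Qed.
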